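(* Let $\zeta\in(0,1)$, $c>0$, $x_0\in\mathbb{X}$, let $P^*$ be a diffuse probability measure on $\mathbb{X}$, and set $P_0=\zeta\delta_{x_0}+(1-\zeta)P^*$. Let $\tilde P\sim\mathrm{hNRMI}(\rho;c,P_0)$ and, for $n\ge1$, let $X_1,\dots,X_n$ be conditionally i.i.d. from $\tilde P$ given $\tilde P$. For $a,u>0$ let $X_{a,u}$ denote a random variable with density proportional to $s^a e^{-us}\rho(s)$ on $(0,\infty)$, and assume that $\rho$ is such that, for any finite collection of independent random variables $X_{a_1,u},\dots,X_{a_m,u}$, the distribution of $\sum_{i=1}^m X_{a_i,u}$ depends on $(a_1,\dots,a_m)$ only through $\sum_{i=1}^m a_i$. Then, for any $k\in\{1,\dots,n\}$, the number $K_n$ of distinct values in $(X_1,\dots,X_n)$ satisfies $$\Pr(K_n=k;\zeta)=(1-\zeta)^k\Pr(K_n=k;0)+(1-\zeta)^{k-1}\sum_{r=1}^{n-k+1}\binom nr\Pr(K_{n-r}=k-1;0)\,\Pr\big(N_0^{(n)}=r\mid K_{n-r}=k-1;\zeta\big),$$ where $N_0^{(n)}=\mathrm{card}\{i\le n:X_i=x_0\}$ and $\Pr(N_0^{(n)}=r\mid K_{n-r}=k-1;\zeta)$ denotes the conditional probability, under the model with base measure $P_0$, that $N_0^{(n)}=r$ (equivalently, that $X_{n-r+1},\dots,X_n$ all equal $x_0$) given that $X_1,\dots,X_{n-r}$ display exactly $k-1$ distinct values, none of which equals $x_0$.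
   Context: $\mathbb{X}$ is a Polish space with its Borel $\sigma$-algebra. A completely random measure (CRM) on $\mathbb{X}$ is a random measure $\tilde\mu$ such that $\tilde\mu(A_1),\dots,\tilde\mu(A_k)$ are mutually independent for all pairwise disjoint measurable $A_1,\dots,A_k$. Let $\rho:(0,\infty)\to[0,\infty)$ be measurable with $\int_0^\infty\min(1,s)\rho(s)\,ds<\infty$ and $\int_0^\infty\rho(s)\,ds=\infty$. For $c>0$ and a probability measure $H$ on $\mathbb{X}$, let $\tilde\mu$ be the (homogeneous, almost surely finite) CRM with Lévy intensity $\rho(s)\,ds\,c\,H(dx)$, i.e. for every measurable $g:\mathbb{X}\to[0,\infty)$, $$\mathbb{E}\Big[e^{-\int g\,d\tilde\mu}\Big]=\exp\Big\{-c\int_{\mathbb{X}}\int_0^\infty(1-e^{-sg(x)})\rho(s)\,ds\,H(dx)\Big\}.$$ $\mathrm{hNRMI}(\rho;c,H)$ denotes the law of the random probability measure $\tilde\mu/\tilde\mu(\mathbb{X})$. $\Pr(\cdot;\zeta)$ is probability under the model with base measure $P_0$; $\Pr(\cdot;0)$ is probability when the $X_i$ are instead conditionally i.i.d. from a random probability measure with law $\mathrm{hNRMI}(\rho;c,P^* )$ (diffuse base measure). Conventions: $K_0=0$, so $\Pr(K_0=0;0)=1$ and $\Pr(K_m=0;0)=0$ for $m\ge1$; a summand with $\Pr(K_{n-r}=k-1;0)=0$ is zero; when $k=1$ and $r=n$ the conditional probability is the unconditional $\Pr(N_0^{(n)}=n;\zeta)$. The variables $X_{a,u}$ in the assumption on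 $\rho$ are considered for those $a,u>0$ for which $s^ae^{-us}\rho(s)$ is integrable on $(0,\infty)$ (always the case when $a\ge1$). *)

(* Defs.v *)
(* MathComp-Analysis; the real line is an arbitrary R : realType. *)
From HB Require Import structures.
From mathcomp Require Import all_boot all_order all_algebra.
From mathcomp Require Import all_classical all_reals all_analysis.
From mathcomp Require Import measurable_realfun.

Set Implicit Arguments.
Unset Strict Implicit.
Unset Printing Implicit Defensive.

Import Order.TTheory GRing.Theory Num.Theory.
Import numFieldNormedType.Exports.

Local Open Scope classical_set_scope.
Local Open Scope ring_scope.
Local Open Scope ereal_scope.

(* Separable and homeomorphic (via f, with inverse g) to a complete metric
   space M. *)
Definition polish (R : realType) (T : topologicalType) : Prop :=
  (exists2 D : set T, countable D & dense D) /\
  (exists (M : metricType R) (f : T -> M) (g : M -> T),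
    [/\ cancel f g, cancel g f, continuous f, continuous g &
        forall F : set_system M, ProperFilter F -> cauchy F -> exists x : M, F --> x]).

Definition borel (T : ptopologicalType) :
    measurableType (@open T).-sigma :=
  g_sigma_algebraType (@open T).

Definition diffuse (d : measure_display) (T : measurableType d) (R : realType)
    (H : probability T R) : Prop :=
  forall x : T, H [set x] = 0.

(* Since some of the B i may be the full space, the product rule for the whole
   family contains the product rule for every subfamily. *)
Definition mutually_independent (d d' : measure_display)
    (Omega : measurableType d) (E : measurableType d') (R : realType)
    (P : probability Omega R) (m : nat) (Y : 'I_m -> Omega -> E) : Prop :=
  forall B : 'I_m -> set E, (forall i, measurable (B i)) ->
    P (\bigcap_i (Y i @^-1` B i)) = \prod_(i < m) P (Y i @^-1` B i).

Definition completely_random (d d' : measure_display)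
    (Omega : measurableType d) (T : measurableType d') (R : realType)
    (P : probability Omega R) (mu : R.-ker Omega ~> T) : Prop :=
  forall (m : nat) (A : 'I_m -> set T),
    (forall i, measurable (A i)) -> trivIset setT A ->
    mutually_independent P (fun i w => mu w (A i)).

(* mu is an a.s. finite CRM with Levy intensity rho(s) ds c H(dx). *)
Definition CRM_with_intensity (d d' : measure_display)
    (Omega : measurableType d) (T : measurableType d') (R : realType)
    (P : probability Omega R) (mu : R.-ker Omega ~> T)
    (rho : R -> R) (c : R) (H : probability T R) : Prop :=
  [/\ completely_random P mu,
      {ae P, forall w, mu w setT < +oo} &
      forall g : T -> R, measurable_fun setT g -> (forall x, (0 <= g x)%R) ->
        \int[P]_w expeR (- \int[mu w]_x (g x)%:E) =
        expeR (- (c%:E * \int[H]_x \int[lebesgue_measure]_(s in `]0%R, +oo[)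
                    ((1 - expR (- (s * g x))) * rho s)%:E))].

(* L is hNRMI(rho; c, H), a law on the space of probability measures on T with
   the sigma-algebra generated by the evaluations.  [mnormalize nu H] is
   nu / nu(T), with the irrelevant default value H when nu(T) is 0 or +oo, which
   has probability zero when the jump intensity rho has infinite mass. *)
Definition is_hNRMI (d' : measure_display) (T : measurableType d')
    (R : realType) (rho : R -> R) (c : R) (H : probability T R)
    (L : probability (pprobability T R) R) : Prop :=
  exists (d : measure_display) (Omega : measurableType d)
    (P : probability Omega R) (mu : R.-ker Omega ~> T),
    CRM_with_intensity P mu rho c H /\
    forall D : set (pprobability T R), measurable D ->
      L D = P ((fun w => mnormalize (mu w) H : pprobability T R) @^-1` D).

(* X_1, ..., X_n are conditionally i.i.d. from Q given Q: the conditional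
   probability of {X_1 in A_1, ..., X_n in A_n} given the sigma-algebra
   generated by Q is Q(A_1) ... Q(A_n). *)
Definition conditionally_iid (d d' : measure_display)
    (Omega : measurableType d) (T : measurableType d') (R : realType)
    (P : probability Omega R) (Q : {RV P >-> pprobability T R})
    (n : nat) (X : 'I_n -> {RV P >-> T}) : Prop :=
  forall (D : set (pprobability T R)) (A : 'I_n -> set T),
    measurable D -> (forall i, measurable (A i)) ->
    P (Q @^-1` D `&` \bigcap_i (X i @^-1` A i)) =
    \int[P]_(w in Q @^-1` D) \prod_(i < n) (Q w : probability T R) (A i).

Definition hNRMI_sample (d d' : measure_display)
    (Omega : measurableType d) (T : measurableType d') (R : realType)
    (P : probability Omega R) (Q : {RV P >-> pprobability T R})
    (n : nat) (X : 'I_n -> {RV P >-> T})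
    (rho : R -> R) (c : R) (H : probability T R) : Prop :=
  is_hNRMI rho c H (distribution P Q) /\ conditionally_iid Q X.

Definition tilted_density (R : realType) (rho : R -> R) (a u s : R) : R :=
  (s `^ a * expR (- (u * s)) * rho s)%R.

Definition tilted_integrable (R : realType) (rho : R -> R) (a u : R) : Prop :=
  (@lebesgue_measure R).-integrable `]0%R, +oo[
    (fun s => (tilted_density rho a u s)%:E).

(* Y has density proportional to s^a e^{-us} rho(s) on (0, +oo). *)
Definition has_tilted_law (d : measure_display) (Omega : measurableType d)
    (R : realType) (P : probability Omega R) (rho : R -> R) (a u : R)
    (Y : {RV P >-> R}) : Prop :=
  forall B : set R, measurable B ->
    P (Y @^-1` B) =
    (\int[lebesgue_measure]_(s in `]0%R, +oo[ `&` B)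
       (tilted_density rho a u s)%:E) *
    ((fine (\int[lebesgue_measure]_(s in `]0%R, +oo[)
       (tilted_density rho a u s)%:E))^-1)%:E.

(* For each u and each number m of summands, the law of
   X_{a_1,u} + ... + X_{a_m,u} (independent summands) depends on (a_1,...,a_m)
   only through a_1 + ... + a_m. *)
Definition sum_law_depends_on_total (R : realType) (rho : R -> R) : Prop :=
  forall (u : R) (m : nat) (a b : 'I_m -> R),
    (0 < u)%R ->
    (forall i, (0 < a i)%R /\ tilted_integrable rho (a i) u) ->
    (forall i, (0 < b i)%R /\ tilted_integrable rho (b i) u) ->
    (\sum_(i < m) a i = \sum_(i < m) b i)%R ->
  forall (d1 : measure_display) (Omega1 : measurableType d1)
    (P1 : probability Omega1 R) (Y : 'I_m -> {RV P1 >-> R})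
    (d2 : measure_display) (Omega2 : measurableType d2)
    (P2 : probability Omega2 R) (Z : 'I_m -> {RV P2 >-> R}),
    mutually_independent P1 (fun i => Y i : Omega1 -> R) ->
    (forall i, has_tilted_law rho (a i) u (Y i)) ->
    mutually_independent P2 (fun i => Z i : Omega2 -> R) ->
    (forall i, has_tilted_law rho (b i) u (Z i)) ->
  forall B : set R, measurable B ->
    P1 [set w | B (\sum_(i < m) Y i w)%R] =
    P2 [set w | B (\sum_(i < m) Z i w)%R].

(* K_m, the number of distinct values among the first m of n observations. *)
Definition distinct_values (Omega : Type) (T : eqType) (n : nat)
    (X : 'I_n -> Omega -> T) (m : nat) (w : Omega) : nat :=
  size (undup [seq X i w | i : 'I_n <- enum 'I_n & (i < m)%N]).

Definition count_at (Omega : Type) (T : eqType) (n : nat)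
    (X : 'I_n -> Omega -> T) (x0 : T) (w : Omega) : nat :=
  #|[pred i : 'I_n | X i w == x0]|.

Definition prob (d : measure_display) (Omega : measurableType d)
    (R : realType) (P : probability Omega R) (A : set Omega) : R :=
  fine (P A).

(* Equal to 0 when P B = 0, by the convention x / 0 = 0. *)
Definition cond_prob (d : measure_display) (Omega : measurableType d)
    (R : realType) (P : probability Omega R) (A B : set Omega) : R :=
  (prob P (A `&` B) / prob P B)%R.

(* Main.v *)
(* Only two consequences of the Lévy intensity are needed: the law of the ratio
   mu(A)/mu(X) depends on the base measure H only through H(A), because the
   Laplace functional of a 1_A + b 1_{A^c} does; and its mean is H(A).
   So E[(mu(A)/mu(X))^m] = F_m(H(A)) with F_m Lipschitz.

   Let the observations be X_1, ..., X_m and cut the space minus x_0 into many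
   small cells, each kept independently with probability t.  On the one hand,
   all observations lie in kept cells with probability t^(number of cells hit),
   and this number is eventually the number of distinct values.  On the other
   hand the kept mass concentrates around t times the total mass.  In the limit
     sum_k t^k Pr(K_m = k, no X_i equals x_0) = F_m(t (1 - zeta)),
   and sum_k t^k Pr(K_m = k; 0) = F_m(t) in the diffuse model.  Comparing
   coefficients,
     Pr(K_m = k, no X_i equals x_0; zeta) = (1 - zeta)^k Pr(K_m = k; 0).
   The same limit shows that the probability that exactly the X_i with i in I
   equal x_0 and that there are k other values depends on I only through its
   cardinality.  Summing over I gives the formula. *)
Require Import Defs.
From HB Require Import structures.
From mathcomp Require Import all_boot all_order all_algebra.
From mathcomp Require Import all_classical all_reals all_analysis.
From mathcomp Require Import measurable_realfun.
From mathcomp Require Import ring lra zify.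

Set Implicit Arguments.
Unset Strict Implicit.
Unset Printing Implicit Defensive.

Import Order.TTheory GRing.Theory Num.Theory.
Import numFieldNormedType.Exports.

Local Open Scope classical_set_scope.
Local Open Scope ring_scope.

(** * Bounded measurable functions on a probability space *)

(** The Laplace functional gives no direct access to a quotient. But mu(A)/mu(X) is a bounded limit
    of polynomials in exp(-mu(A)/N) and exp(-mu(X)/N), and the mixed moments of these two variables
    are values of the Laplace transform of the pair formed by mu(A) and the mass of the complement.
    Moments are therefore compared directly, without inverting a transform. The mean is identified
    as the only additive nonnegative function on [0,1] with value 1 at 1; additivity is tested on
    nested sets of every mass, which the diffuse measure supplies. The Lipschitz bound follows from
    the mean: for nested sets of masses p <= q the difference of m-th powers lies between 0 and m
    times the difference of the masses, of expectation m(q - p). This bound lets the concentration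
    take place in the base measure. For a fixed choice of kept cells the m-th moment of their random
    mass is F_m of their base mass, a deterministic number, so only a sum of independently kept
    numbers p_c has to concentrate. Its variance t(1-t) sum p_c^2 tends to 0 because [Pstar] is
    diffuse. The same F_m serves both models. *)

Section bounded_measurable.
Context d (T : measurableType d) (R : realType) (P : probability T R).
Implicit Types f g : T -> R.

(** Closed under sums, products and powers, and integrable against every probability: integrability
    of the integrands below follows from their shape. *)
Definition bounded_mfun f :=
  measurable_fun setT f /\ exists M, forall x, `|f x| <= M.

Lemma bounded_mfun_integrable f : bounded_mfun f ->
  P.-integrable setT (EFin \o f).
Proof.
move=> [mf [M fM]]; apply: measurable_bounded_integrable => //.
  by rewrite (le_lt_trans (probability_le1 P measurableT))// ltry.
exists M; split; first exact: num_real.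
by move=> x Mx y _ /=; exact: le_trans (fM y) (ltW Mx).
Qed.

Lemma bounded_mfun_cst (a : R) : bounded_mfun (fun=> a).
Proof. by split; [exact: measurable_cst|exists `|a|]. Qed.

Lemma bounded_mfunD f g : bounded_mfun f -> bounded_mfun g ->
  bounded_mfun (fun x => f x + g x).
Proof.
move=> [mf [M fM]] [mg [N gN]]; split; first exact: measurable_funD.
by exists (M + N) => x; rewrite (le_trans (ler_normD _ _))// lerD.
Qed.

Lemma bounded_mfunM f g : bounded_mfun f -> bounded_mfun g ->
  bounded_mfun (fun x => f x * g x).
Proof.
move=> [mf [M fM]] [mg [N gN]]; split; first exact: measurable_funM.
by exists (M * N) => x; rewrite normrM ler_pM.
Qed.

Lemma bounded_mfunB f g : bounded_mfun f -> bounded_mfun g ->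
  bounded_mfun (fun x => f x - g x).
Proof.
move=> bf bg; apply: bounded_mfunD => //.
have := bounded_mfunM (bounded_mfun_cst (-1)) bg.
by under eq_fun do rewrite mulN1r.
Qed.

Lemma bounded_mfunX f n : bounded_mfun f -> bounded_mfun (fun x => f x ^+ n).
Proof.
move=> bf; elim: n => [|n IH].
  by under eq_fun do rewrite expr0; exact: bounded_mfun_cst.
by under eq_fun do rewrite exprS; exact: bounded_mfunM.
Qed.

Lemma bounded_mfun_sum (I : Type) (s : seq I) (h : I -> T -> R) :
  (forall i, bounded_mfun (h i)) -> bounded_mfun (fun x => \sum_(i <- s) h i x).
Proof.
move=> bh; elim: s => [|i s IH].
  by under eq_fun do rewrite big_nil; exact: bounded_mfun_cst.
by under eq_fun do rewrite big_cons; exact: bounded_mfunD.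
Qed.

Lemma bounded_mfun_indic (A : set T) : measurable A -> bounded_mfun \1_A.
Proof.
by move=> mA; split => //; exists 1 => x; rewrite indicE; case: (_ \in _);
  rewrite ?normr1 ?normr0.
Qed.

Lemma Rintegral_sum (I : Type) (s : seq I) (h : I -> T -> R) :
  (forall i, bounded_mfun (h i)) ->
  \int[P]_x (\sum_(i <- s) h i x) = \sum_(i <- s) \int[P]_x h i x.
Proof.
move=> bh; elim: s => [|i s IH].
  rewrite big_nil; under eq_Rintegral do rewrite big_nil.
  by rewrite Rintegral_cst// mul0r.
rewrite big_cons -IH; under eq_Rintegral do rewrite big_cons.
by rewrite RintegralD//; apply: bounded_mfun_integrable => //;
  exact: bounded_mfun_sum.
Qed.

Lemma Rintegral_indic (A : set T) : measurable A ->
  \int[P]_x (\1_A x) = fine (P A).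
Proof. by move=> mA; rewrite /Rintegral integral_indic// setIT. Qed.

Lemma Rintegral_probability_cst (a : R) : \int[P]_x a = a.
Proof. by rewrite Rintegral_cst//= probability_setT mulr1. Qed.

Lemma bounded_convergence (f_ : nat -> T -> R) f (M : R) :
  (forall n, measurable_fun setT (f_ n)) -> measurable_fun setT f ->
  (forall n x, `|f_ n x| <= M) ->
  {ae P, forall x, f_ ^~ x @ \oo --> f x} ->
  (fun n => \int[P]_x f_ n x) @ \oo --> \int[P]_x f x.
Proof.
move=> mf_ mf fM f_f.
have [|||||intf _ cvgf] := @dominated_convergence _ _ _ P setT measurableT
  (fun n => EFin \o f_ n) (EFin \o f) (EFin \o cst M).
- by move=> n; exact/measurable_EFinP.
- exact/measurable_EFinP.
- by move: f_f; apply: filterS => x fx _; apply: cvg_EFin => /=; [exact: nearW|exact: fx].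
- exact: bounded_mfun_integrable (bounded_mfun_cst M).
- by apply: aeW => x m _ /=; rewrite lee_fin fM.
apply: fine_cvg; rewrite fineK; first exact: cvgf.
exact: (integrable_fin_num measurableT intf).
Qed.

End bounded_measurable.
Arguments bounded_mfun_cst {d T R} a.

(** * Laplace transforms determine the moments of a ratio *)

Section ratio_approximation.
Context {R : realType}.
Implicit Types (a b t x y : R) (n m : nat).

(* With x = exp(-a/N), y = exp(-(a+b)/N) and K = N^2, this tends to
   a/(a+b) as N tends to infinity, and it is a polynomial in x and y. *)
Definition ratio_poly (K : nat) x y : R := (1 - x) * \sum_(j < K) y ^+ j.

(** Replacing [1 - x] by the larger [1 - y] turns the product into [1 - y ^+ K], at most 1. The
    bound is uniform in [K], as bounded convergence requires. *)
Lemma ratio_poly_itv K x y : 0 <= y -> y <= x -> x <= 1 ->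
  0 <= ratio_poly K x y <= 1.
Proof.
move=> y0 yx x1; have s0 : 0 <= \sum_(j < K) y ^+ j.
  by apply: sumr_ge0 => j _; exact: exprn_ge0.
rewrite /ratio_poly mulr_ge0 ?subr_ge0//=.
have := subrX1 y K => /eqP; rewrite -subr_eq0 => /eqP e.
have : 0 <= y ^+ K by exact: exprn_ge0.
have : (1 - x) * (\sum_(j < K) y ^+ j) <= (1 - y) * (\sum_(j < K) y ^+ j).
  by apply: ler_wpM2r => //; lra.
lra.
Qed.

(** Squeeze with N = n+1: the inequality exp(z) >= 1 + z gives the upper bound t at z = -t/N and the
    lower bound t/(1 + t/N) at z = t/N. *)
Lemma cvg_scaled_1BexpRN t : 0 <= t ->
  n.+1%:R * (1 - expR (- (t / n.+1%:R))) @[n --> \oo] --> t.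
Proof.
move=> t0.
have h : t / (1 + t * n.+1%:R^-1) @[n --> \oo] --> t.
  have h1 : (1 + t * n.+1%:R^-1) @[n --> \oo] --> (1 + t * 0 : R).
    apply: cvgD; first exact: cvg_cst.
    by apply: cvgMl_tmp; exact: (@cvg_harmonic R).
  rewrite -[X in _ --> X](_ : t / (1 + t * 0) = _); last first.
    by rewrite mulr0 addr0 divr1.
  apply: cvgMl_tmp; apply: cvgV h1; rewrite mulr0 addr0; exact: oner_neq0.
apply: (squeeze_cvgr _ h (cvg_cst t)).
apply: nearW => n.
have n0 : (0 : R) < n.+1%:R by rewrite ltr0n.
set z := t / n.+1%:R.
have z0 : 0 <= z by rewrite divr_ge0// ltW.
have -> : t = n.+1%:R * z by rewrite mulrC divfK// gt_eqF.
rewrite -/z -mulrA !ler_pM2l//.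
have e1 := expR_ge1Dx z; have e2 := expR_ge1Dx (- z).
have e3 : expR (- z) * (1 + z) <= 1.
  rewrite expRN mulrC ler_pdivrMr ?expR_gt0// mul1r//.
apply/andP; split; last by lra.
rewrite ler_pdivrMr; last by lra.
by lra.
Qed.

(** Summing the geometric series gives (u/v)(1 - e) with u -> a and v -> a + b. Although y tends to
    1, taking N^2 terms makes the remainder e = exp(-(a+b)N) vanish. *)
Lemma ratio_poly_cvg a b : 0 <= a -> 0 <= b -> 0 < a + b ->
  ratio_poly (n.+1 * n.+1) (expR (- (a / n.+1%:R)))
                           (expR (- ((a + b) / n.+1%:R))) @[n --> \oo]
    --> a / (a + b).
Proof.
move=> a0 b0 ab0.
pose u n : R := n.+1%:R * (1 - expR (- (a / n.+1%:R))).
pose v n : R := n.+1%:R * (1 - expR (- ((a + b) / n.+1%:R))).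
pose e n : R := expR (- ((a + b) * n.+1%:R)).
have n0 n : (0 : R) < n.+1%:R by rewrite ltr0n.
have v0 n : v n != 0.
  rewrite mulf_neq0 ?gt_eqF// subr_gt0 -expR0 ltr_expR oppr_lt0.
  by rewrite divr_gt0.
have e0 : e n @[n --> \oo] --> (0 : R).
  have h : (a + b)^-1 * n.+1%:R^-1 @[n --> \oo] --> ((a + b)^-1 * 0 : R).
    by apply: cvgMl_tmp; exact: (@cvg_harmonic R).
  rewrite mulr0 in h.
  apply: (squeeze_cvgr _ (cvg_cst (0 : R)) h); apply: nearW => n.
  rewrite expR_ge0/= /e expRN -invfM lef_pV2 ?posrE ?expR_gt0 ?mulr_gt0//.
  by rewrite (le_trans _ (expR_ge1Dx _))// lerDr.
have E n : ratio_poly (n.+1 * n.+1) (expR (- (a / n.+1%:R)))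
      (expR (- ((a + b) / n.+1%:R))) = (u n / v n) * (1 - e n).
  rewrite /ratio_poly.
  have := subrX1 (expR (- ((a + b) / n.+1%:R))) (n.+1 * n.+1).
  set S := \sum_(_ < _) _ => eS.
  have eE : expR (- ((a + b) / n.+1%:R)) ^+ (n.+1 * n.+1) = e n.
    rewrite -expRM_natl /e; congr expR.
    by rewrite natrM; field; rewrite gt_eqF.
  rewrite eE in eS; have vn := v0 n.
  have -> : 1 - e n = (v n / n.+1%:R) * S.
    by rewrite /v [_ / n.+1%:R]mulrC mulKf ?gt_eqF// -[LHS]opprB eS; ring.
  rewrite /u; field; rewrite vn gt_eqF//.
under eq_fun do rewrite E.
have -> : a / (a + b) = a / (a + b) * (1 - 0) by rewrite subr0 mulr1.
apply: cvgM.
  apply: cvgM; first exact: cvg_scaled_1BexpRN.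
  apply: cvgV; first by rewrite gt_eqF.
  by apply: cvg_scaled_1BexpRN; exact: ltW.
by apply: cvgB => //; exact: cvg_cst.
Qed.

End ratio_approximation.

Section moment_transfer.
Context (R : realType) d1 (T1 : measurableType d1) (P1 : probability T1 R)
  d2 (T2 : measurableType d2) (P2 : probability T2 R).

Lemma eq_moments_ratio_poly (x1 y1 : T1 -> R) (x2 y2 : T2 -> R) (K m : nat) :
  bounded_mfun x1 -> bounded_mfun y1 -> bounded_mfun x2 -> bounded_mfun y2 ->
  (forall i j : nat, \int[P1]_w (x1 w ^+ i * y1 w ^+ j) =
                     \int[P2]_w (x2 w ^+ i * y2 w ^+ j)) ->
  \int[P1]_w ratio_poly K (x1 w) (y1 w) ^+ m =
  \int[P2]_w ratio_poly K (x2 w) (y2 w) ^+ m.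
Proof.
move=> bx1 by1 bx2 by2 xy.
(* The monomial factor strengthens the induction: multiplying f by [1 - x] or by powers of y only
   shifts the exponents i and j, so equality for all exponents is preserved. *)
pose good (f : R -> R -> R) :=
  [/\ bounded_mfun (fun w => f (x1 w) (y1 w)),
      bounded_mfun (fun w => f (x2 w) (y2 w)) &
      forall i j : nat, \int[P1]_w (x1 w ^+ i * y1 w ^+ j * f (x1 w) (y1 w)) =
                        \int[P2]_w (x2 w ^+ i * y2 w ^+ j * f (x2 w) (y2 w))].
have good_mulx f : good f -> good (fun x y => (1 - x) * f x y).
  move=> [bf1 bf2 ef].
  have b d (T : measurableType d) (x y : T -> R) :
      bounded_mfun x -> bounded_mfun (fun w => f (x w) (y w)) ->
      bounded_mfun (fun w => (1 - x w) * f (x w) (y w)).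
    move=> bx bf; apply: bounded_mfunM => //.
    by apply: bounded_mfunB => //; exact: bounded_mfun_cst.
  have e d (T : measurableType d) (P : probability T R) (x y : T -> R) i j :
      bounded_mfun x -> bounded_mfun y ->
      bounded_mfun (fun w => f (x w) (y w)) ->
      \int[P]_w (x w ^+ i * y w ^+ j * ((1 - x w) * f (x w) (y w))) =
      \int[P]_w (x w ^+ i * y w ^+ j * f (x w) (y w)) -
      \int[P]_w (x w ^+ i.+1 * y w ^+ j * f (x w) (y w)).
    move=> bx bY bf; rewrite -RintegralB//.
    - by apply: eq_Rintegral => w _; rewrite exprS; ring.
    - by apply: bounded_mfun_integrable; do !apply: bounded_mfunM => //;
        exact: bounded_mfunX.
    - by apply: bounded_mfun_integrable; do !apply: bounded_mfunM => //;
        exact: bounded_mfunX.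
  by split; [exact: b|exact: b|move=> i j; rewrite !e// !ef].
have good_muly f : good f -> good (fun x y => (\sum_(k < K) y ^+ k) * f x y).
  move=> [bf1 bf2 ef].
  have b d (T : measurableType d) (x y : T -> R) :
      bounded_mfun y -> bounded_mfun (fun w => f (x w) (y w)) ->
      bounded_mfun (fun w => (\sum_(k < K) y w ^+ k) * f (x w) (y w)).
    move=> bY bf; apply: bounded_mfunM => //.
    by apply: bounded_mfun_sum => k; exact: bounded_mfunX.
  have e d (T : measurableType d) (P : probability T R) (x y : T -> R) i j :
      bounded_mfun x -> bounded_mfun y ->
      bounded_mfun (fun w => f (x w) (y w)) ->
      \int[P]_w (x w ^+ i * y w ^+ j * ((\sum_(k < K) y w ^+ k) * f (x w) (y w)))
      = \sum_(k < K) \int[P]_w (x w ^+ i * y w ^+ (j + k) * f (x w) (y w)).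
    move=> bx bY bf; rewrite -Rintegral_sum.
      apply: eq_Rintegral => w _; rewrite mulr_suml mulr_sumr.
      by apply: eq_bigr => k _; rewrite exprD; ring.
    by move=> k; do !apply: bounded_mfunM => //; exact: bounded_mfunX.
  split; [exact: b|exact: b|move=> i j; rewrite !e//].
  by apply: eq_bigr => k _; rewrite ef.
have : good (fun x y => ratio_poly K x y ^+ m).
  elim: m => [|m IH].
    split; [exact: bounded_mfun_cst|exact: bounded_mfun_cst|move=> i j].
    have := xy i j; congr (_ = _); apply: eq_Rintegral => w _;
      by rewrite expr0 mulr1.
  have := good_mulx _ (good_muly _ IH); congr good.
  by apply/funext => x; apply/funext => y; rewrite exprS /ratio_poly mulrA.
move=> [_ _ /(_ 0%N 0%N)]; congr (_ = _); apply: eq_Rintegral => w _;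
  by rewrite !expr0 !mul1r.
Qed.

(** Each side is the limit, by bounded convergence, of expectations of the same polynomials in
    exp(-a/N) and exp(-(a+b)/N), and these expectations agree for every N. *)
Lemma eq_laplace_ratio (a1 b1 q1 : T1 -> R) (a2 b2 q2 : T2 -> R) (m : nat) :
  measurable_fun setT q1 -> measurable_fun setT q2 ->
  measurable_fun setT a1 -> measurable_fun setT b1 ->
  measurable_fun setT a2 -> measurable_fun setT b2 ->
  (forall w, 0 <= a1 w) -> (forall w, 0 <= b1 w) ->
  (forall w, 0 <= a2 w) -> (forall w, 0 <= b2 w) ->
  {ae P1, forall w, 0 < a1 w + b1 w /\ q1 w = a1 w / (a1 w + b1 w)} ->
  {ae P2, forall w, 0 < a2 w + b2 w /\ q2 w = a2 w / (a2 w + b2 w)} ->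
  (forall s t : R, 0 <= s -> 0 <= t ->
     \int[P1]_w expR (- (s * a1 w + t * b1 w)) =
     \int[P2]_w expR (- (s * a2 w + t * b2 w))) ->
  \int[P1]_w q1 w ^+ m = \int[P2]_w q2 w ^+ m.
Proof.
move=> mq1 mq2 ma1 mb1 ma2 mb2 a10 b10 a20 b20 ab1 ab2 lap.
pose x d (T : measurableType d) (a : T -> R) (n : nat) w : R :=
  expR (- (a w / n.+1%:R)).
have bx d (T : measurableType d) (a : T -> R) n : measurable_fun setT a ->
    (forall w, 0 <= a w) -> bounded_mfun (x _ _ a n).
  move=> ma a0; split.
    apply: measurableT_comp => //; apply: measurableT_comp => //.
    exact: measurable_funM.
  exists 1 => w; rewrite ger0_norm ?expR_ge0// -expR0 ler_expR oppr_le0.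
  by rewrite divr_ge0.
have key d (T : measurableType d) (P : probability T R) (a b q : T -> R) :
    measurable_fun setT q ->
    measurable_fun setT a -> measurable_fun setT b ->
    (forall w, 0 <= a w) -> (forall w, 0 <= b w) ->
    {ae P, forall w, 0 < a w + b w /\ q w = a w / (a w + b w)} ->
    (fun n => \int[P]_w ratio_poly (n.+1 * n.+1) (x _ _ a n w)
                           (x _ _ (a \+ b) n w) ^+ m) @ \oo
      --> \int[P]_w q w ^+ m.
  move=> mq ma mb a0 b0 ab.
  have mab : measurable_fun setT (a \+ b) by exact: measurable_funD.
  have ab0 w : 0 <= (a \+ b) w by rewrite addr_ge0.
  have mr n : measurable_fun setT
      (fun w => ratio_poly (n.+1 * n.+1) (x _ _ a n w) (x _ _ (a \+ b) n w)).
    apply: measurable_funM.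
      by apply: measurable_funB => //; have [] := bx _ _ _ n ma a0.
    apply: measurable_sum => j; apply: measurable_funX.
    by have [] := bx _ _ _ n mab ab0.
  apply: (@bounded_convergence _ _ _ P _ _ 1).
  - by move=> n; apply: measurable_funX; exact: mr.
  - exact: measurable_funX.
  - move=> n w.
    have /andP[r0 r1] : 0 <= ratio_poly (n.+1 * n.+1) (x _ _ a n w)
        (x _ _ (a \+ b) n w) <= 1.
      apply: ratio_poly_itv; first exact: expR_ge0.
        by rewrite ler_expR lerN2 ler_pM2r ?invr_gt0// lerDl.
      by rewrite -expR0 ler_expR oppr_le0 divr_ge0.
    by rewrite ger0_norm ?exprn_ge0// exprn_ile1.
  - move: ab; apply: filterS => w [abw ->].
    have := ratio_poly_cvg (a0 w) (b0 w) abw.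
    exact: (continuous_cvg _ (@exprn_continuous R m _)).
have e n : \int[P1]_w ratio_poly (n.+1 * n.+1) (x _ _ a1 n w)
      (x _ _ (a1 \+ b1) n w) ^+ m =
    \int[P2]_w ratio_poly (n.+1 * n.+1) (x _ _ a2 n w)
      (x _ _ (a2 \+ b2) n w) ^+ m.
  apply: eq_moments_ratio_poly.
  - exact: bx.
  - by apply: bx => [|w]; [exact: measurable_funD|rewrite addr_ge0].
  - exact: bx.
  - by apply: bx => [|w]; [exact: measurable_funD|rewrite addr_ge0].
  move=> i j.
  have n0 : (0 : R) < n.+1%:R by rewrite ltr0n.
  (* With N = n+1, x^i y^j = exp(-(i a + j (a+b))/N), so the mixed moment is the Laplace transform
     at ((i+j)/N, j/N). *)
  have := lap ((i + j)%:R / n.+1%:R) (j%:R / n.+1%:R).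
  move=> /(_ (divr_ge0 (ler0n _ _) (ltW n0)) (divr_ge0 (ler0n _ _) (ltW n0))).
  have E d (T : measurableType d) (P : probability T R) (a b : T -> R) :
    \int[P]_w (x _ _ a n w ^+ i * x _ _ (a \+ b) n w ^+ j) =
    \int[P]_w expR (- ((i + j)%:R / n.+1%:R * a w + j%:R / n.+1%:R * b w)).
    apply: eq_Rintegral => w _; rewrite /x -!expRM_natl -expRD; congr expR => /=.
    by rewrite natrD; field; rewrite gt_eqF.
  by rewrite !E.
have k1 := key _ _ P1 _ _ _ mq1 ma1 mb1 a10 b10 ab1.
have k2 := key _ _ P2 _ _ _ mq2 ma2 mb2 a20 b20 ab2.
rewrite -(funext e) in k2.
exact: (cvg_unique _ k1 k2).
Qed.

End moment_transfer.

(** * Normalized completely random measures *)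

Section normalized_CRM.
Context (R : realType) (rho : R -> R) (c : R).
Hypothesis rho_meas : measurable_fun (`]0, +oo[ : set R) rho.
Hypothesis rho_ge0 : forall s : R, 0 < s -> 0 <= rho s.
Hypothesis rho_infinite : (\int[lebesgue_measure]_(s in `]0%R, +oo[)
                       (rho s)%:E = +oo)%E.
Hypothesis c_gt0 : 0 < c.

(** Laplace exponent of the subordinator with Lévy density [rho]: the total mass of the random
    measure has Laplace transform exp(-c psi(s)), with psi this function. *)
Definition laplace_exponent (s : R) : \bar R :=
  (\int[lebesgue_measure]_(u in `]0%R, +oo[)
     ((1 - expR (- (u * s))) * rho u)%:E)%E.

Lemma laplace_exponent_ge0 s : 0 <= s -> (0 <= laplace_exponent s)%E.
Proof.
move=> s0; apply: integral_ge0 => u /=; rewrite in_itv/= andbT => u0.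
rewrite lee_fin mulr_ge0 ?rho_ge0// subr_ge0 -expR0 ler_expR oppr_le0.
by rewrite mulr_ge0// ltW.
Qed.

(** The factor 1 - exp(-un) increases to 1 for u > 0, so monotone convergence yields the total mass
    of [rho], which is infinite. This is what excludes a vanishing random measure. *)
Lemma laplace_exponent_cvgy : laplace_exponent n%:R @[n --> \oo] --> +oo%E.
Proof.
pose g (n : nat) (u : R) : \bar R := ((1 - expR (- (u * n%:R))) * rho u)%:E.
have mg n : measurable_fun (`]0%R, +oo[%classic : set R) (g n).
  apply/measurable_EFinP; apply: measurable_funM => //.
  apply: measurable_funTS; apply: measurable_funB => //.
  apply: measurableT_comp => //; apply: measurableT_comp => //.
  exact: measurable_funM.
have g0 n u : (`]0%R, +oo[%classic : set R) u -> (0 <= g n u)%E.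
  rewrite /= in_itv/= andbT => u0.
  rewrite lee_fin mulr_ge0 ?rho_ge0// subr_ge0 -expR0 ler_expR oppr_le0.
  by rewrite mulr_ge0// ltW.
have ndg u : (`]0%R, +oo[%classic : set R) u -> nondecreasing_seq (g^~ u).
  rewrite /= in_itv/= andbT => u0 n m nm.
  rewrite lee_fin ler_wpM2r ?rho_ge0// lerB// ler_expR lerN2.
  by rewrite ler_pM2l// ler_nat.
have := @cvg_monotone_convergence _ _ _ lebesgue_measure _
  (measurable_itv `]0, +oo[) _ mg g0 ndg.
rewrite (_ : (\int[_]_(_ in _) _)%E = +oo%E)//.
rewrite -rho_infinite; apply: eq_integral => u.
rewrite inE /= in_itv/= andbT => u0; apply/cvg_lim => //.
rewrite /g; apply: cvg_EFin => /=; first exact: nearW.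
have e0 : expR (- (u * n%:R)) @[n --> \oo] --> (0 : R).
  have h : u^-1 * n.+1%:R^-1 @[n --> \oo] --> (u^-1 * 0 : R).
    by apply: cvgMl_tmp; exact: (@cvg_harmonic R).
  rewrite mulr0 in h; rewrite -(cvg_shiftS (fun n => expR (- (u * n%:R)))) /=.
  apply: (squeeze_cvgr _ (cvg_cst (0 : R)) h); apply: nearW => n.
  have n0 : (0 : R) < n.+1%:R by rewrite ltr0n.
  rewrite expR_ge0/= expRN -invfM lef_pV2 ?posrE ?expR_gt0 ?mulr_gt0//.
  by rewrite (le_trans _ (expR_ge1Dx _))// lerDr.
have := cvgM (cvgB (cvg_cst (1 : R)) e0) (cvg_cst (rho u)).
by rewrite subr0 mul1r => h; exact: h.
Qed.

Section one_CRM.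
Context d d' (Omega : measurableType d) (T : measurableType d')
  (P : probability Omega R) (mu : R.-ker Omega ~> T) (H : probability T R).
Hypothesis crm : CRM_with_intensity P mu rho c H.

(** The test function equal to s on A and to t off A makes both integrals split, and H survives only
    through the masses of A and its complement. *)
Lemma CRM_laplace2 (A : set T) (s t : R) : measurable A -> 0 <= s -> 0 <= t ->
  (\int[P]_w expeR (- (s%:E * mu w A + t%:E * mu w (~` A))) =
   expeR (- (c%:E * (laplace_exponent s * H A +
                     laplace_exponent t * H (~` A)))))%E.
Proof.
move=> mA s0 t0; have [_ _ /(_ (fun x => if x \in A then s else t))] := crm.
have mAc : measurable (~` A) by exact: measurableC.
have split_int (nu : {measure set T -> \bar R}) (a b : \bar R) :
    (0 <= a)%E -> (0 <= b)%E ->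
    (\int[nu]_x (if x \in A then a else b) = a * nu A + b * nu (~` A))%E.
  move=> a0 b0; have m : measurable_fun setT (fun x => if x \in A then a else b).
    apply: measurable_fun_ifT => //; apply: (measurable_fun_bool true).
    rewrite setTI [X in measurable X](_ : _ = A)//.
    by apply/seteqP; split => x /=; [move/set_mem|move/mem_set].
  rewrite -(setUv A) ge0_integral_setU//.
  - rewrite -integral_cst// -[(b * _)%E]integral_cst//; congr (_ + _)%E.
      by apply: eq_integral => x ->.
    by apply: eq_integral => x; rewrite in_setC => /negbTE ->.
  - by rewrite setUv.
  - by move=> x _; case: ifP.
  - by apply/disj_setPS; rewrite setICr.
move=> h; have := h.
  rewrite (_ : (fun w => _) = fun w =>
      expeR (- (s%:E * mu w A + t%:E * mu w (~` A))))%E; last first.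
    apply/funext => w; rewrite -split_int ?lee_fin//; congr (expeR (- _))%E.
    by apply: eq_integral => x _; case: ifP.
  rewrite (_ : (\int[H]_x _)%E = (laplace_exponent s * H A +
                     laplace_exponent t * H (~` A))%E); last first.
    rewrite -split_int ?laplace_exponent_ge0//.
    by apply: eq_integral => x _; case: ifP.
apply => //; last by move=> x; case: ifP.
apply: measurable_fun_ifT => //; apply: (measurable_fun_bool true).
rewrite setTI [X in measurable X](_ : _ = A)//.
by apply/seteqP; split => x /=; [move/set_mem|move/mem_set].
Qed.

Lemma measurable_expeRN (f : Omega -> \bar R) : measurable_fun setT f ->
  measurable_fun setT (fun w => expeR (- f w)).
Proof.
(* The two infinite values are separated as measurable cases, so that the remaining branch is
   real-valued. *)
move=> mf; pose g (x : \bar R) : \bar R :=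
  if x == -oo%E then +oo%E else if x == +oo%E then 0%E else (expR (- fine x))%:E.
have mg : measurable_fun setT g.
  apply: measurable_fun_ifT.
  - apply: (measurable_fun_bool true).
    rewrite setTI [X in measurable X](_ : _ = [set -oo%E]) ?emeasurable_set1//.
    by apply/seteqP; split => x /= /eqP.
  - exact: measurable_cst.
  apply: measurable_fun_ifT.
  - apply: (measurable_fun_bool true).
    rewrite setTI [X in measurable X](_ : _ = [set +oo%E]) ?emeasurable_set1//.
    by apply/seteqP; split => x /= /eqP.
  - exact: measurable_cst.
  apply/measurable_EFinP; apply: measurableT_comp => //.
  exact: measurableT_comp.
rewrite (_ : (fun w => _) = g \o f); first exact: measurableT_comp.
by apply/funext => w /=; rewrite /g; case: (f w).
Qed.

(** Chernoff bound: the indicator of a vanishing total mass is at most exp(-n mu(X)), whose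
    expectation exp(-c psi(n)) tends to 0. *)
Lemma CRM_total_neq0 : {ae P, forall w, mu w setT != 0%E}.
Proof.
pose Z := [set w | mu w setT == 0%E].
have mZ : measurable Z by exact: kernel_measurable_eq_cst.
suff PZ : P Z = 0%E.
  by exists Z; split => // w /=; move/negP; rewrite negbK.
apply/eqP; rewrite eq_le measure_ge0 andbT.
apply/lee_addgt0Pr => e e0; rewrite add0e.
(* Chosen so that c psi(n) >= -ln e, that is exp(-c psi(n)) <= e. *)
have [n hn] : exists n : nat, ((- (ln e) / c)%:E <= laplace_exponent n%:R)%E.
  have /cvgeyPge/(_ (- (ln e) / c)) := laplace_exponent_cvgy.
  by move=> [n _ /(_ n (leqnn n))] hn; exists n.
have := @CRM_laplace2 setT n%:R 0 measurableT (ler0n _ _) (lexx _).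
rewrite setCT measure0 mule0 adde0 probability_setT mule1 => lap.
apply: (@le_trans _ _ (expeR (- (c%:E * laplace_exponent n%:R)))%E).
  rewrite -lap (_ : P Z = \int[P]_w (\1_Z w)%:E)%E; last first.
    by rewrite integral_indic// setIT.
  apply: ge0_le_integral => //.
  - by apply/measurable_EFinP; exact: measurable_indic.
  - apply: measurable_expeRN.
    rewrite (_ : (fun w => _) = (fun w => n%:R%:E * mu w setT)%E).
      by apply: measurable_funeM; exact: measurable_kernel.
    by apply/funext => w; rewrite measure0 mule0 adde0.
  - move=> w _; rewrite indicE; have [/set_mem/eqP ->|_] := boolP (w \in Z).
      by rewrite measure0 !mule0 adde0 oppe0 expeR0.
    exact: expeR_ge0.
have -> : e%:E = expeR (ln e)%:E by rewrite /= lnK.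
rewrite lee_expeR leeNl -EFinN.
apply: (@le_trans _ _ (c%:E * (- ln e / c)%:E)%E).
  by rewrite -EFinM lee_fin mulrC divfK// gt_eqF.
by rewrite lee_pmul2l// lte_fin.
Qed.

Lemma CRM_total_fin : {ae P, forall w, mu w setT \is a fin_num}.
Proof.
have [_ + _] := crm; apply: filterS => w.
by rewrite ge0_fin_numE.
Qed.

End one_CRM.

(** The pairs of masses of A and of its complement have the same Laplace transform in both models,
    since equal base masses of the sets force equal base masses of the complements. The default
    value in [mnormalize] is met only on a null set. *)
Theorem normalized_CRM_moment d1 d1' (Omega1 : measurableType d1)
  (T1 : measurableType d1') (P1 : probability Omega1 R)
  (mu1 : R.-ker Omega1 ~> T1) (H1 : probability T1 R)
  d2 d2' (Omega2 : measurableType d2) (T2 : measurableType d2')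
  (P2 : probability Omega2 R) (mu2 : R.-ker Omega2 ~> T2)
  (H2 : probability T2 R) (A1 : set T1) (A2 : set T2) (m : nat) :
  CRM_with_intensity P1 mu1 rho c H1 -> CRM_with_intensity P2 mu2 rho c H2 ->
  measurable A1 -> measurable A2 -> H1 A1 = H2 A2 ->
  \int[P1]_w fine (mnormalize (mu1 w) H1 A1) ^+ m =
  \int[P2]_w fine (mnormalize (mu2 w) H2 A2) ^+ m.
Proof.
move=> crm1 crm2 mA1 mA2 HA.
have HAc : H1 (~` A1) = H2 (~` A2) by rewrite !probability_setC ?HA.
pose a d d' (Omega : measurableType d) (T : measurableType d')
  (mu : R.-ker Omega ~> T) (A : set T) w := fine (mu w A).
have ma d d' (Omega : measurableType d) (T : measurableType d')
    (mu : R.-ker Omega ~> T) (A : set T) : measurable A ->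
    measurable_fun setT (a _ _ _ _ mu A).
  by move=> mA; apply: measurableT_comp => //; exact: measurable_kernel.
have mq d d' (Omega : measurableType d) (T : measurableType d')
    (mu : R.-ker Omega ~> T) (H : probability T R) (A : set T) :
    measurable A ->
    measurable_fun setT (fun w => fine (mnormalize (mu w) H A)).
  move=> mA; apply: measurableT_comp => //.
  exact: (measurable_kernel (knormalize mu H)).
have q_ratio d d' (Omega : measurableType d) (T : measurableType d')
    (P : probability Omega R)
    (mu : R.-ker Omega ~> T) (H : probability T R) (A : set T) :
    CRM_with_intensity P mu rho c H -> measurable A ->
    {ae P, forall w, 0 < a _ _ _ _ mu A w + a _ _ _ _ mu (~` A) w /\
      fine (mnormalize (mu w) H A) =
      a _ _ _ _ mu A w / (a _ _ _ _ mu A w + a _ _ _ _ mu (~` A) w)}.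
  move=> crm mA; have := CRM_total_neq0 crm; have := CRM_total_fin crm.
  apply: filterS2 => w fin n0.
  have mAc : measurable (~` A) by exact: measurableC.
  have AcE : (mu w A + mu w (~` A) = mu w setT)%E.
    by rewrite -measureU ?setUv// setICr.
  have [fA fAc] : mu w A \is a fin_num /\ mu w (~` A) \is a fin_num.
    by apply/andP; move: fin; rewrite -AcE fin_numD.
  have tE : a _ _ _ _ mu A w + a _ _ _ _ mu (~` A) w = fine (mu w setT).
    by rewrite -AcE fineD.
  rewrite tE; split; first by rewrite fine_gt0// lt0e n0 measure_ge0/= -ge0_fin_numE.
  rewrite /mnormalize (negbTE n0)/=; case: ifP => [/eqP h|_].
    by move: fin; rewrite h.
  by rewrite fineM.
have lap d d' (Omega : measurableType d) (T : measurableType d')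
    (P : probability Omega R)
    (mu : R.-ker Omega ~> T) (H : probability T R) (A : set T) (s t : R) :
    CRM_with_intensity P mu rho c H -> measurable A -> 0 <= s -> 0 <= t ->
    \int[P]_w expR (- (s * a _ _ _ _ mu A w + t * a _ _ _ _ mu (~` A) w)) =
    fine (expeR (- (c%:E * (laplace_exponent s * H A +
                     laplace_exponent t * H (~` A)))))%E.
  move=> crm mA s0 t0; rewrite -(CRM_laplace2 crm mA s0 t0) /Rintegral.
  have mAc : measurable (~` A) by exact: measurableC.
  (* The real and the extended integrands agree wherever the total mass is finite, hence almost
     everywhere. *)
  congr fine; apply: ae_eq_integral => //.
  - apply/measurable_EFinP; apply: measurableT_comp => //.
    apply: measurableT_comp => //.
    by apply: measurable_funD; apply: measurable_funM => //; exact: ma.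
  - apply: measurable_expeRN; apply: emeasurable_funD;
      by apply: measurable_funeM; exact: measurable_kernel.
  have := CRM_total_fin crm; apply: filterS => w fin _.
  have [fA fAc] : mu w A \is a fin_num /\ mu w (~` A) \is a fin_num.
    apply/andP; move: fin.
    by rewrite -(setUv A) measureU// ?setICr// fin_numD.
  by rewrite -[mu w A]fineK// -[mu w (~` A)]fineK.
apply: (@eq_laplace_ratio _ _ _ _ _ _ _ (a _ _ _ _ mu1 A1)
  (a _ _ _ _ mu1 (~` A1)) _ (a _ _ _ _ mu2 A2) (a _ _ _ _ mu2 (~` A2))).
- exact: mq.
- exact: mq.
- exact: ma.
- by apply: ma; exact: measurableC.
- exact: ma.
- by apply: ma; exact: measurableC.
- by move=> w; exact: fine_ge0.
- by move=> w; exact: fine_ge0.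
- by move=> w; exact: fine_ge0.
- by move=> w; exact: fine_ge0.
- exact: q_ratio.
- exact: q_ratio.
by move=> s t s0 t0; rewrite (lap _ _ _ _ _ _ H1)// (lap _ _ _ _ _ _ H2)// HA HAc.
Qed.

End normalized_CRM.

(** * Separating sequences and sets of prescribed mass *)

Section separating_sequence.
Context d (T : measurableType d).

(** The form in which the Polish topology enters the argument: such a sequence makes points
    measurable, injects the space into the reals and cuts it into cells. *)
Definition separating (B : nat -> set T) :=
  (forall i, measurable (B i)) /\
  (forall x y, (forall i, B i x <-> B i y) -> x = y).

Lemma separating_measurable1 (B : nat -> set T) (x : T) :
  separating B -> measurable [set x].
Proof.
move=> [mB sB].
rewrite (_ : [set x] = \bigcap_i (if x \in B i then B i else ~` B i)).
  apply: bigcapT_measurable => i; case: ifP => _; first exact: mB.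
  exact: measurableC.
apply/seteqP; split => [y -> i _|y h /=]; first by case: ifPn; rewrite ?inE ?notin_setE.
apply: sB => i; have := h i I.
case: ifPn => /=; rewrite ?inE ?notin_setE//.
Qed.

End separating_sequence.

Lemma polish_separating (R : realType) (T : ptopologicalType) :
  polish R T -> exists B : nat -> set (borel T), separating B.
Proof.
move=> [[D /countable_injP[phi phi_inj] denseD] [M [f [g [fgK gfK cf cg _]]]]].
have openB (x : M) (e : R) : open ((f : T -> M) @^-1` (ball x e)°).
  by move/continuousP: cf; apply; exact: open_interior.
(* A ball around the point of [D] with code i. Since [phi] is injective on [D] the union has at most
   one term, and it is empty when i codes no point. *)
pose C (i n : nat) : set T :=
  \bigcup_(x in [set x | D x /\ phi x = i]) (f @^-1` (ball (f x) n.+1%:R^-1)°).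
exists (fun k => if unpickle k is Some (i, n) then C i n else set0).
split=> [k|y z yz].
  case: unpickle => [[i n]|]; last exact: measurable0.
  by apply: sub_sigma_algebra; apply: bigcup_open => x _; exact: openB.
apply: (can_inj fgK); apply/eqP/negPn/negP; rewrite -mdist_gt0 => yz0.
(* Below half the distance, a ball of this radius that contains f y cannot contain f z. *)
have [n hn] : exists n : nat, n.+1%:R^-1 < mdist (f y) (f z) / 2.
  have h0 : 0 < mdist (f y) (f z) / 2 by rewrite divr_gt0.
  exists (Num.trunc (mdist (f y) (f z) / 2)^-1).
  rewrite invf_plt ?posrE//; first exact: truncnS_gt.
have n0 : (0 : R) < n.+1%:R^-1 by rewrite invr_gt0 ltr0n.
have ball_int (x v : M) (e : R) : ball x e v -> (ball x e)° v.
  rewrite ballEmdist/= => xv; rewrite /interior/=.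
  have e0 : 0 < e - mdist x v by rewrite subr_gt0.
  apply/nbhs_ballP; exists (e - mdist x v) => //= w; rewrite !ballEmdist/= => vw.
  by rewrite (le_lt_trans (metric_triangle _ v _))// -ltrBrDl.
have [x [xy Dx]] : (f @^-1` (ball (f y) n.+1%:R^-1)°) `&` D !=set0.
  apply: denseD; last exact: openB.
  by exists y; apply: ball_int; exact: ballxx.
have yB : (f @^-1` (ball (f x) n.+1%:R^-1)°) y.
  by apply: ball_int; apply: ball_sym; exact: interior_subset xy.
have := yz (pickle (phi x, n)); rewrite pickleK => -[/(_ _)[]].
  by exists x.
move=> x' [Dx' phix'] /interior_subset x'z _.
have e : x' = x by apply: phi_inj; rewrite ?inE.
move: x'z (interior_subset xy); rewrite e ballEmdist ballEmdist/= => xz yx.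
have := le_lt_trans (metric_triangle (f y) (f x) (f z)) (ltrD yx xz).
apply/negP; rewrite -leNgt -mulr2n -[leLHS]mulr_natr -ler_pdivlMr ?ltr0n//. exact: ltW.
Qed.

Section injection_to_reals.
Context d (T : measurableType d) (R : realType) (B : nat -> set T).
Hypothesis sepB : separating B.

(** Membership in the sets [B i] is read as the digits 0 and 1 of a base 3 expansion. Base 3 makes
    this injective: at the first differing index i one side gains 3^-i, while all later digits
    together are worth at most half of that. The whole sum is at most 3/2, hence the range. *)
Lemma separating_real_injection : exists U : T -> R,
  [/\ measurable_fun setT U, injective U & forall x, 0 <= U x <= 2].
Proof.
have [mB sB] := sepB.
pose b i x : R := 3^-1 ^+ i * \1_(B i) x.
pose u n x : R := \sum_(i < n) b i x.
have uS n x : u n.+1 x = u n x + b n x by rewrite /u big_ord_recr.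
have p0 i : (0 : R) <= 3^-1 ^+ i by rewrite exprn_ge0.
have b0 i x : 0 <= b i x by rewrite mulr_ge0// indicE.
have b1 i x : b i x <= 3^-1 ^+ i by rewrite ler_piMr// indicE lern1 leq_b1.
have ndu x : nondecreasing_seq (u^~ x).
  by apply/nondecreasing_seqP => n; rewrite uS lerDl.
have tail n k x : u (n + k)%N x <= u n x + 3 / 2 * (3^-1 ^+ n - 3^-1 ^+ (n + k)).
  elim: k => [|k IH]; first by rewrite addn0 subrr mulr0 addr0.
  rewrite addnS uS exprS; have := b1 (n + k)%N x; lra.
have ub n m x : u m x <= u n x + 3 / 2 * 3^-1 ^+ n.
  have [mn|/ltnW nm] := leqP m n.
    by rewrite (le_trans (ndu x _ _ mn))// lerDl mulr_ge0.
  have := tail n (m - n)%N x; rewrite subnKC//.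
  have := p0 m; lra.
have cu x : cvgn (u^~ x).
  apply: nondecreasing_is_cvgn => //.
  by exists (u 0%N x + 3 / 2 * 3^-1 ^+ 0) => _ [m _ <-]; exact: ub.
pose U x := limn (u^~ x).
have Ulow n x : u n x <= U x by exact: nondecreasing_cvgn_le.
have Uup n x : U x <= u n x + 3 / 2 * 3^-1 ^+ n.
  by apply: limr_le => //; apply: nearW => m; exact: ub.
have u0 x : u 0%N x = 0 by rewrite /u big_ord0.
exists U; split.
- apply: (@measurable_fun_cvg _ _ _ _ u) => [n|x _]; last exact: cu.
  apply: measurable_sum => i; apply: measurable_funM => //.
- have key x y i : (forall j, (j < i)%N -> B j x <-> B j y) ->
      B i x -> ~ B i y -> U x != U y.
    move=> ij xi yi; rewrite gt_eqF//.
    have e : u i x = u i y.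
      apply: eq_bigr => j _; rewrite /b !indicE; congr (_ * (nat_of_bool _)%:R).
      by apply/idP/idP => /set_mem h; apply/mem_set; apply/(ij j (ltn_ord j)).
    have := Ulow i.+1 x; have := Uup i.+1 y; rewrite !uS e exprS /b !indicE.
    rewrite (mem_set xi) (memNset yi) /=.
    have : (0 : R) < 3^-1 ^+ i by rewrite exprn_gt0.
    lra.
  move=> x y /eqP Uxy; apply: sB; apply: contrapT => /existsNP h.
  (* The first index of disagreement; the long term only turns the failure of the equivalence into a
     boolean inequality. *)
  have [i hi mini] := ex_minnP (P := fun i => (x \in B i) != (y \in B i))
    (let: ex_intro i hi := h in ex_intro _ i (introN eqP (fun e => hi
      (conj (fun p => set_mem (etrans (esym e) (mem_set p)))
            (fun p => set_mem (etrans e (mem_set p))))))).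
  have ij j : (j < i)%N -> B j x <-> B j y.
    move=> ji; have : ~~ ((x \in B j) != (y \in B j)).
      by apply/negP => /mini; rewrite leqNgt ji.
    rewrite negbK => /eqP e; split => /mem_set; first by rewrite e => /set_mem.
    by rewrite -e => /set_mem.
  move: hi; have [/set_mem xi|] := boolP (x \in B i).
    rewrite eq_sym eqb_id => /negP yi; have := key x y i ij xi.
    by rewrite Uxy => /(_ (fun p => yi (mem_set p))).
  move=> /negP xi; rewrite eq_sym eqbF_neg negbK => /set_mem yi.
  have := key y x i (fun j ji => iff_sym (ij j ji)) yi (fun p => xi (mem_set p)).
  by rewrite eq_sym Uxy.
- move=> x; have := Ulow 0%N x; have := Uup 0%N x; rewrite u0 expr0 => h1 ->/=.
  lra.
Qed.

End injection_to_reals.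

(** The sets are sublevel sets of the real injection [U]. Its distribution function [G] is
    continuous under a diffuse measure, so the intermediate value theorem provides a quantile for
    every p. *)
Lemma diffuse_nested_sets d (T : measurableType d) (R : realType)
    (B : nat -> set T) (H : probability T R) : separating B -> diffuse H ->
  exists A : R -> set T,
    [/\ forall p, measurable (A p),
        forall p, 0 <= p <= 1 -> H (A p) = p%:E &
        forall p q, 0 <= p -> p <= q -> q <= 1 -> A p `<=` A q].
Proof.
move=> sepB dH.
have [U [mU injU U02]] := separating_real_injection R sepB.
have mUle x : measurable [set w | U w <= x].
  rewrite (_ : [set w | _] = U @^-1` `]-oo, x]); last first.
    by apply/seteqP; split => w /=; rewrite in_itv.
  by rewrite -[X in measurable X]setTI; exact: mU.
pose G x := fine (H [set w | U w <= x]).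
have GE x : H [set w | U w <= x] = (G x)%:E by rewrite fineK// fin_num_measure.
have ndG x y : x <= y -> G x <= G y.
  move=> xy; rewrite fine_le ?fin_num_measure//.
  by apply: le_measure; rewrite ?inE// => w /= /le_trans; exact.
have ltnV (r : R) : 0 < r -> exists n : nat, n.+1%:R^-1 < r.
  move=> r0; exists (Num.trunc r^-1).
  by rewrite invf_plt ?posrE//; exact: truncnS_gt.
have leV (m n : nat) : (m <= n)%N -> n.+1%:R^-1 <= m.+1%:R^-1 :> R.
  by move=> mn; rewrite lef_pV2 ?posrE ?ltr0n// ler_nat.
have rc x e : 0 < e -> exists n : nat, G (x + n.+1%:R^-1) < G x + e.
  move=> e0; pose F (n : nat) := [set w | U w <= x + n.+1%:R^-1].
  have capF : \bigcap_n F n = [set w | U w <= x].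
    apply/seteqP; split => [w h /=|w /= h n _]; last first.
      by rewrite /F/= (le_trans h)// lerDl.
    rewrite leNgt; apply/negP => xU.
    have [n hn] : exists n : nat, n.+1%:R^-1 < U w - x.
      by apply: ltnV; rewrite subr_gt0.
    by have := h n I; rewrite /F/=; move: hn; set r := _^-1; lra.
  have cF : H (F n) @[n --> \oo] --> H (\bigcap_n F n).
    apply: nonincreasing_cvg_mu => //.
    - by rewrite (le_lt_trans (probability_le1 H (mUle _)))// ltry.
    - by move=> ?; exact: mUle.
    - by rewrite capF.
    - move=> m n mn; apply/subsetPset => w; rewrite /F/= => h.
      by rewrite (le_trans h)// lerD2l leV.
  rewrite capF in cF.
  rewrite GE in cF.
  have cG : G (x + n.+1%:R^-1) @[n --> \oo] --> G x by exact: fine_cvg cF.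
  move/cvgrPdist_lt : cG => /(_ e e0)[n _ /(_ n (leqnn n))]/= hn.
  by exists n; move: hn; rewrite ltr_norml; set z := G (x + _); lra.
(* A level set of the injective [U] is empty or a point, hence null: [G] has no jump, and left
   continuity follows. *)
have U1 x : H [set w | U w = x] = 0%E.
  have [[w Uw]|nex] := pselect (exists w, U w = x).
    rewrite [X in H X](_ : _ = [set w])//.
    by apply/seteqP; split => v /=; [rewrite -Uw => /injU|move=> ->].
  rewrite [X in H X](_ : _ = set0) ?measure0//.
  by apply/seteqP; split => // v Uv; apply: nex; exists v.
have lc x e : 0 < e -> exists n : nat, G x - e < G (x - n.+1%:R^-1).
  move=> e0; pose F (n : nat) := [set w | U w <= x - n.+1%:R^-1].
  have mUeq : measurable [set w | U w = x].
    rewrite (_ : [set w | _] = U @^-1` [set x])//.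
    by rewrite -[X in measurable X]setTI; exact: mU.
  have cupF : \bigcup_n F n = [set w | U w <= x] `\` [set w | U w = x].
    apply/seteqP; split => [w [n _]|w /= [h1 h2]].
      rewrite /F/= => h; have n0 : (0 : R) < n.+1%:R^-1 by rewrite invr_gt0 ltr0n.
      by move: h n0; set r := _^-1 => h n0; split; [lra|apply/eqP; rewrite lt_eqF//; lra].
    have [n hn] : exists n : nat, n.+1%:R^-1 < x - U w.
      by apply: ltnV; rewrite subr_gt0 lt_neqAle h1 andbT; apply/eqP.
    by exists n => //; rewrite /F/=; move: hn; set r := _^-1; lra.
  have cF : H (F n) @[n --> \oo] --> H (\bigcup_n F n).
    apply: nondecreasing_cvg_mu => //.
    - by move=> ?; exact: mUle.
    - by rewrite cupF; exact: measurableD.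
    - move=> m n mn; apply/subsetPset => w; rewrite /F/= => h.
      by rewrite (le_trans h)// lerB// leV.
  have HU : H (\bigcup_n F n) = (G x)%:E.
    rewrite cupF measureD//; last first.
      by rewrite (le_lt_trans (probability_le1 H (mUle _)))// ltry.
    rewrite setIidr; last by move=> w /= ->.
    by rewrite -[RHS]sube0; congr (_ - _)%E; [exact: GE|exact: U1].
  rewrite HU in cF.
  have cG : G (x - n.+1%:R^-1) @[n --> \oo] --> G x by exact: fine_cvg cF.
  move/cvgrPdist_lt : cG => /(_ e e0)[n _ /(_ n (leqnn n))]/= hn.
  by exists n; move: hn; rewrite ltr_norml; set z := G (x - _); lra.
have cG : continuous G.
  move=> x; apply/cvgrPdist_lt => e e0.
  have [n hn] := rc x e e0; have [m hm] := lc x e e0.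
  have n0 : (0 : R) < n.+1%:R^-1 by rewrite invr_gt0 ltr0n.
  have m0 : (0 : R) < m.+1%:R^-1 by rewrite invr_gt0 ltr0n.
  apply/nbhs_ballP; exists (Num.min n.+1%:R^-1 m.+1%:R^-1).
    by rewrite /= lt_min n0.
  move=> y; rewrite /ball/= lt_min !ltr_norml; move: hn hm n0 m0.
  set r := n.+1%:R^-1; set s := m.+1%:R^-1.
  move=> hn hm n0 m0 /andP[/andP[xy1 xy2] /andP[xy3 xy4]].
  have y1 : y <= x + r by lra.
  have y2 : x - s <= y by lra.
  by have := ndG _ _ y1; have := ndG _ _ y2; lra.
have G0 : G (-1) = 0.
  rewrite /G [X in H X](_ : _ = set0) ?measure0//.
  by apply/seteqP; split => // w /=; have /andP[] := U02 w; lra.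
have G1 : G 2 = 1.
  rewrite /G [X in H X](_ : _ = setT) ?probability_setT//.
  by apply/seteqP; split => // w _ /=; have /andP[] := U02 w.
have h p : exists c, 0 <= p <= 1 -> G c = p.
  have [p01|] := boolP (0 <= p <= 1); last by exists 0.
  have [|||c _ Gc] := @IVT R G (-1) 2 p; last by exists c.
  - lra.
  - exact: continuous_subspaceT.
  - by rewrite G0 G1 min_l ?max_r.
pose c p := sval (cid (h p)).
have Gc p : 0 <= p <= 1 -> G (c p) = p := svalP (cid (h p)).
exists (fun p => [set w | U w <= c p]); split => // [p p01|p q p0 pq q1 w /=].
  by rewrite GE Gc.
move=> /le_trans; apply.
(* For p = q the same chosen quantile is used twice; for p < q, quantiles in the reverse order would
   give q <= p because [G] is nondecreasing. *)
move: pq; rewrite le_eqVlt => /predU1P[->//|pq].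
rewrite leNgt; apply/negP => /ltW/ndG.
rewrite !Gc; lra.
Qed.

(** * Moments as a function of the base mass *)

Section additive_on_unit_interval.
Context {R : realType}.

(** Cauchy's equation on the unit interval: f is the identity at multiples of r = 1/(N+1), and
    nonnegativity makes it monotone between them. *)
Lemma additive_unit_id (f : R -> R) :
  (forall p q, 0 <= p -> p <= q -> q <= 1 -> f (q - p) = f q - f p) ->
  (forall p, 0 <= p <= 1 -> 0 <= f p) -> f 1 = 1 ->
  forall p, 0 <= p <= 1 -> f p = p.
Proof.
move=> addf f0 f1.
have f00 : f 0 = 0 by have := addf 0 0 (lexx _) (lexx _) ler01; rewrite !subrr.
have ndf p q : 0 <= p -> p <= q -> q <= 1 -> f p <= f q.
  move=> p0 pq q1; rewrite -subr_ge0 -addf// f0//; lra.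
have fmul x (j : nat) : 0 <= x -> j%:R * x <= 1 -> f (j%:R * x) = j%:R * f x.
  move=> x0; elim: j => [|j IH]; first by rewrite !mul0r.
  rewrite -natr1 !mulrDl !mul1r => jx.
  have jx0 : 0 <= j%:R * x by rewrite mulr_ge0.
  have := addf (j%:R * x) (j%:R * x + x) jx0 _ jx.
  rewrite addrAC subrr add0r IH; last by lra.
  by rewrite lerDl => /(_ x0); lra.
have fV (N : nat) : f N.+1%:R^-1 = N.+1%:R^-1.
  have N0 : (N.+1%:R : R) != 0 by rewrite pnatr_eq0.
  have := fmul N.+1%:R^-1 N.+1; rewrite divff// f1.
  rewrite invr_ge0 => /(_ (ler0n _ _) (lexx _)) h.
  by apply: (mulfI N0); rewrite -h divff.
move=> p /andP[p0 p1].
suff key (N : nat) : `|f p - p| <= N.+1%:R^-1.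
  apply/eqP; rewrite -subr_eq0 -normr_le0; apply/ler_addgt0Pr => e e0.
  rewrite add0r (le_trans (key (Num.trunc e^-1)))//.
  by rewrite invf_ple ?posrE// ltW// truncnS_gt.
have [r rE] : exists r : R, r = N.+1%:R^-1 by exists N.+1%:R^-1.
rewrite -rE.
have N0 : (0 : R) < N.+1%:R by rewrite ltr0n.
have r0 : 0 < r by rewrite rE invr_gt0.
have [j /andP[j1 j2]] : exists j : nat, j%:R * r <= p < j%:R * r + r.
  exists (Num.trunc (p * N.+1%:R)).
  have /andP[h1 h2] : (Num.trunc (p * N.+1%:R))%:R <= p * N.+1%:R
      < (Num.trunc (p * N.+1%:R)).+1%:R.
    by apply: truncn_itv; rewrite mulr_ge0// ltW.
  rewrite rE ler_pdivrMr// h1/= -[X in _ + X]mul1r -mulrDl natr1.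
  by rewrite ltr_pdivlMr.
have jr0 : 0 <= j%:R * r by rewrite mulr_ge0// ltW.
have := addf (j%:R * r) p jr0 j1 p1.
rewrite fmul ?(ltW r0)//; last by lra.
have fr : f r = r by rewrite rE fV.
rewrite fr => e.
have s0 : 0 <= p - j%:R * r by lra.
have r1 : r <= 1 by rewrite rE invf_le1 ?ler1n.
have := ndf (p - j%:R * r) r s0; rewrite fr => /(_ _ r1).
have := f0 (p - j%:R * r).
(* With j r the grid point below p, both f(p - j r) and p - j r lie in [0, r], so they differ by at
   most r. *)
have -> : f p - p = f (p - j%:R * r) - (p - j%:R * r) by lra.
move=> h1 h2; rewrite ler_norml.
have {}h1 := h1 ltac:(lra); have {}h2 := h2 ltac:(lra).
by apply/andP; split; lra.
Qed.

Lemma subr_exp_le (x y : R) m : 0 <= x -> x <= y -> y <= 1 ->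
  0 <= y ^+ m - x ^+ m <= m%:R * (y - x).
Proof.
move=> x0 xy y1; apply/andP; split.
  by rewrite subr_ge0 lerXn2r// nnegrE (le_trans x0).
elim: m => [|m IH]; first by rewrite !expr0 subrr mul0r.
have e : y ^+ m.+1 - x ^+ m.+1 = y * (y ^+ m - x ^+ m) + x ^+ m * (y - x).
  by rewrite !exprS; ring.
rewrite e -natr1 mulrDl mul1r lerD//.
  apply: le_trans IH; rewrite ler_piMl// subr_ge0 lerXn2r// nnegrE.
  exact: le_trans xy.
by rewrite ler_piMl ?subr_ge0// exprn_ile1// (le_trans xy).
Qed.

End additive_on_unit_interval.

Section moment_function.
Context (R : realType) (rho : R -> R) (c : R).
Hypothesis rho_meas : measurable_fun (`]0, +oo[ : set R) rho.
Hypothesis rho_ge0 : forall s : R, 0 < s -> 0 <= rho s.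
Hypothesis rho_infinite : (\int[lebesgue_measure]_(s in `]0%R, +oo[)
                       (rho s)%:E = +oo)%E.
Hypothesis c_gt0 : 0 < c.

(* Nested sets of every mass under the diffuse base measure make the moment a
   function of the mass alone, and identify the first moment. *)
Theorem normalized_CRM_moment_function d d' (Omega : measurableType d)
  (T : measurableType d') (P : probability Omega R) (mu : R.-ker Omega ~> T)
  (H : probability T R) (B : nat -> set T) :
  CRM_with_intensity P mu rho c H -> separating B -> diffuse H ->
  exists F : nat -> R -> R,
    [/\ forall m p q, 0 <= p -> p <= q -> q <= 1 ->
          0 <= F m q - F m p <= m%:R * (q - p),
        forall m, F m 1 = 1 &
        forall d2 d2' (Omega2 : measurableType d2) (T2 : measurableType d2')
          (P2 : probability Omega2 R) (mu2 : R.-ker Omega2 ~> T2)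
          (H2 : probability T2 R) (A2 : set T2) (m : nat),
          CRM_with_intensity P2 mu2 rho c H2 -> measurable A2 ->
          \int[P2]_w fine (mnormalize (mu2 w) H2 A2) ^+ m =
          F m (fine (H2 A2))].
Proof.
move=> crm sepB dH.
have [A [mA HA ndA]] := diffuse_nested_sets sepB dH.
pose M C w : R := fine (mnormalize (mu w) H C).
have mM C : measurable C -> measurable_fun setT (M C).
  move=> mC; apply: measurableT_comp => //.
  exact: (measurable_kernel (knormalize mu H)).
have M01 C w : measurable C -> 0 <= M C w <= 1.
  move=> mC; rewrite fine_ge0//= -lee_fin fineK ?fin_num_measure//.
  exact: probability_le1.
have bM C : measurable C -> bounded_mfun (M C).
  move=> mC; split; [exact: mM|exists 1 => w].
  by have /andP[h0 h1] := M01 C w mC; rewrite ger0_norm.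
have MD C D w : measurable C -> measurable D -> C `<=` D ->
    M (D `\` C) w = M D w - M C w.
  move=> mC mD CD; rewrite /M measureD//; last first.
    by rewrite (le_lt_trans (probability_le1 _ _))// ltry.
  by rewrite setIidr// fineB// fin_num_measure.
pose F m p := \int[P]_w M (A p) w ^+ m.
have FE d2 d2' (Omega2 : measurableType d2) (T2 : measurableType d2')
    (P2 : probability Omega2 R) (mu2 : R.-ker Omega2 ~> T2)
    (H2 : probability T2 R) (A2 : set T2) m :
    CRM_with_intensity P2 mu2 rho c H2 -> measurable A2 ->
    \int[P2]_w fine (mnormalize (mu2 w) H2 A2) ^+ m = F m (fine (H2 A2)).
  move=> crm2 mA2; apply: (normalized_CRM_moment rho_meas rho_ge0 rho_infinite c_gt0) => //.
  rewrite HA ?fineK ?fin_num_measure//.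
  by rewrite fine_ge0//= -lee_fin fineK ?fin_num_measure// probability_le1.
have F1 m : F m 1 = 1.
  have := FE _ _ _ _ _ _ _ setT m crm measurableT; rewrite probability_setT => <-.
  rewrite -[RHS](Rintegral_probability_cst P); apply: eq_Rintegral => w _.
  by rewrite probability_setT expr1n.
have F1E p q : 0 <= p -> p <= q -> q <= 1 -> F 1%N (q - p) = F 1%N q - F 1%N p.
  move=> p0 pq q1.
  have p1 : 0 <= p <= 1 by lra.
  have q01 : 0 <= q <= 1 by lra.
  have HD : H (A q `\` A p) = (q - p)%:E.
    rewrite measureD//; last first.
      by rewrite (le_lt_trans (probability_le1 _ _))// ltry.
    rewrite setIidr; last exact: ndA.
    by rewrite EFinB; congr (_ - _)%E; exact: HA.
  have := FE _ _ _ _ _ _ _ (A q `\` A p) 1%N crm (measurableD (mA q) (mA p)).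
  rewrite HD /= => <-; rewrite -RintegralB//.
  - by apply: eq_Rintegral => w _; rewrite !expr1; apply: MD => //; exact: ndA.
  - by apply: bounded_mfun_integrable; apply: bounded_mfunX; exact: bM.
  - by apply: bounded_mfun_integrable; apply: bounded_mfunX; exact: bM.
have F1id : forall p, 0 <= p <= 1 -> F 1%N p = p.
  apply: additive_unit_id => // p _; apply: Rintegral_ge0 => w _.
  by rewrite expr1; have /andP[] := M01 (A p) w (mA p).
exists F; split => // m p q p0 pq q1.
have iX r k : P.-integrable setT (EFin \o (fun w => M (A r) w ^+ k)).
  by apply: bounded_mfun_integrable; apply: bounded_mfunX; exact: bM.
(* The first powers are kept on the right because their expectations are already known: integrating
   gives m(q - p). *)
have pw w : 0 <= M (A q) w ^+ m - M (A p) w ^+ m <=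
    m%:R * (M (A q) w ^+ 1 - M (A p) w ^+ 1).
  rewrite !expr1; have /andP[h0 h1] := M01 (A q) w (mA q).
  have /andP[h2 h3] := M01 (A p) w (mA p).
  apply: subr_exp_le => //; rewrite -subr_ge0 -MD//; last exact: ndA.
  by have /andP[] := M01 (A q `\` A p) w (measurableD (mA q) (mA p)).
rewrite -RintegralB//; apply/andP; split.
  by apply: Rintegral_ge0 => w _; have /andP[] := pw w.
have -> : q - p = \int[P]_w (M (A q) w ^+ 1 - M (A p) w ^+ 1).
  by rewrite RintegralB// -/(F 1%N q) -/(F 1%N p) !F1id//; lra.
have bX r k : bounded_mfun (fun w => M (A r) w ^+ k).
  by apply: bounded_mfunX; exact: bM.
rewrite -RintegralZl//; last first.
  by apply: bounded_mfun_integrable; exact: bounded_mfunB.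
apply: le_Rintegral => //.
- by apply: bounded_mfun_integrable; exact: bounded_mfunB.
- apply: bounded_mfun_integrable; apply: bounded_mfunM.
    exact: bounded_mfun_cst.
  exact: bounded_mfunB.
- by move=> w _; have /andP[] := pw w.
Qed.

End moment_function.

(** * Random subsets *)

Section bernoulli_subsets.
Context {R : realFieldType} (C : finType).
Implicit Types (t : R) (s S : {set C}).

(** For t in [0,1], the law of a random subset that keeps each element independently with
    probability t. As an explicit weight it makes thinning a finite average, with no enlargement of
    the sample space. *)
Definition bernoulli_weight t S : R := \prod_c (if c \in S then t else 1 - t).

Lemma bernoulli_weight_ge0 t S : 0 <= t <= 1 -> 0 <= bernoulli_weight t S.
Proof. by move=> t01; apply: prodr_ge0 => c _; case: ifP => _; lra. Qed.

(** The probability that the random subset contains s. Expanding a product of factors, equal to t on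
    s and to t + (1 - t) = 1 off s, produces the sum over subsets. *)
Lemma sum_bernoulli_weight_sup t s :
  \sum_(S : {set C}) bernoulli_weight t S * (s \subset S)%:R = t ^+ #|s|.
Proof.
transitivity (\prod_c (t + (1 - t) * (c \notin s)%:R)).
  rewrite bigA_distr; apply: eq_bigr => S _.
  have [sS|/fintype.subsetPn[c cs cS]] := boolP (s \subset S).
    rewrite mulr1; apply: eq_bigr => c _; case: ifPn => // cS.
    by rewrite (contraNN (fintype.subsetP sS c) cS) mulr1.
  by rewrite mulr0 (bigD1 c)//= (negbTE cS) cs mulr0 mul0r.
rewrite (bigID (mem s))/= -[RHS]mulr1; congr (_ * _).
  rewrite -prodr_const; apply: eq_bigr => c ->.
  by rewrite mulr0 addr0.
by rewrite big1// => c ->; rewrite mulr1 addrC subrK.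
Qed.

Lemma sum_bernoulli_weight t : \sum_(S : {set C}) bernoulli_weight t S = 1.
Proof.
have := sum_bernoulli_weight_sup t finset.set0; rewrite cards0 expr0 => <-.
by apply: eq_bigr => S _; rewrite finset.sub0set mulr1.
Qed.

(** Two elements are kept together with probability t^2 when distinct and t when equal, so only the
    diagonal contributes to the covariance. *)
Lemma bernoulli_variance t (p : C -> R) :
  \sum_(S : {set C}) bernoulli_weight t S *
    (\sum_(c in S) p c - t * \sum_c p c) ^+ 2 =
  t * (1 - t) * \sum_c p c ^+ 2.
Proof.
have Ysum S : \sum_(c in S) p c = \sum_c p c * ([set c]%SET \subset S)%:R.
  rewrite big_mkcond/=; apply: eq_bigr => c _.
  by rewrite finset.sub1set; case: ifP; rewrite ?mulr1 ?mulr0.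
have EY : \sum_(S : {set C}) bernoulli_weight t S * \sum_(c in S) p c =
    t * \sum_c p c.
  under eq_bigr do rewrite Ysum mulr_sumr.
  rewrite exchange_big mulr_sumr/=; apply: eq_bigr => c _.
  under eq_bigr do rewrite mulrCA.
  by rewrite -mulr_sumr sum_bernoulli_weight_sup cards1 expr1 mulrC.
have EY2 : \sum_(S : {set C}) bernoulli_weight t S * (\sum_(c in S) p c) ^+ 2 =
    \sum_c \sum_c' p c * p c' * t ^+ #|[set c; c']%SET|.
  transitivity (\sum_(S : {set C}) \sum_c \sum_c'
      p c * p c' * (bernoulli_weight t S * ([set c; c']%SET \subset S)%:R)).
    apply: eq_bigr => S _; rewrite Ysum expr2 mulr_suml mulr_sumr.
    apply: eq_bigr => c _; rewrite !mulr_sumr; apply: eq_bigr => c' _.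
    by rewrite finset.subUset !finset.sub1set; case: (c \in S); case: (c' \in S);
      rewrite /= ?(mulr0, mul0r, mulr1, mul1r)//; ring.
  rewrite exchange_big; apply: eq_bigr => c _.
  rewrite exchange_big; apply: eq_bigr => c' _.
  by rewrite -mulr_sumr sum_bernoulli_weight_sup.
transitivity (\sum_(S : {set C}) bernoulli_weight t S * (\sum_(c in S) p c) ^+ 2
    - (t * \sum_c p c) ^+ 2).
  set a := t * \sum_c p c.
  transitivity (\sum_(S : {set C}) (bernoulli_weight t S * (\sum_(c in S) p c) ^+ 2
    + ((bernoulli_weight t S * \sum_(c in S) p c) * (- 2 * a)
    + bernoulli_weight t S * a ^+ 2))).
    by apply: eq_bigr => S _; ring.
  rewrite !big_split/= -!mulr_suml EY -/a sum_bernoulli_weight; ring.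
rewrite EY2.
transitivity (\sum_c \sum_c' p c * p c' * (t ^+ #|[set c; c']%SET| - t ^+ 2)).
  rewrite exprMn expr2 [(\sum_c p c) ^+ 2]expr2 mulr_suml mulr_sumr -sumrB.
  apply: eq_bigr => c _; rewrite mulr_sumr mulr_sumr -sumrB.
  by apply: eq_bigr => c' _; ring.
rewrite mulr_sumr; apply: eq_bigr => c _.
rewrite (bigD1 c)//= big1 ?addr0 => [|c' c'c].
  by rewrite finset.setUid cards1; ring.
by rewrite cards2 eq_sym c'c /= subrr mulr0.
Qed.

(** A quantitative weak law in the manner of Chebyshev; the free parameter e is balanced against the
    sum of squares once the latter is known to be small. *)
Lemma bernoulli_lipschitz_approx t (p : C -> R) (F : R -> R) (L e : R) :
  0 <= t <= 1 -> (forall c, 0 <= p c) -> \sum_c p c <= 1 -> 0 < e -> 0 <= L ->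
  (forall x y, 0 <= x -> x <= y -> y <= 1 -> 0 <= F y - F x <= L * (y - x)) ->
  `|\sum_(S : {set C}) bernoulli_weight t S * F (\sum_(c in S) p c) -
     F (t * \sum_c p c)| <= L * ((\sum_c p c ^+ 2) / e + e).
Proof.
move=> t01 p0 p1 e0 L0 lipF.
set a := t * \sum_c p c.
have sp0 : 0 <= \sum_c p c by exact: sumr_ge0.
have a0 : 0 <= a by rewrite mulr_ge0//; lra.
have a1 : a <= 1 by rewrite -[leRHS]mulr1 ler_pM//; lra.
have Y01 S : 0 <= \sum_(c in S) p c <= 1.
  rewrite sumr_ge0//=; apply: le_trans p1.
  by rewrite [leRHS](bigID (mem S))/= lerDl sumr_ge0.
have lip x y : 0 <= x <= 1 -> 0 <= y <= 1 -> `|F x - F y| <= L * `|x - y|.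
  move=> /andP[x0 x1] /andP[y0 y1]; have [xy|/ltW yx] := leP x y.
    have /andP[h1 h2] := lipF x y x0 xy y1.
    by rewrite distrC ger0_norm// distrC [`|y - x|]ger0_norm// subr_ge0.
  have /andP[h1 h2] := lipF y x y0 yx x1.
  by rewrite ger0_norm// [`|x - y|]ger0_norm// subr_ge0.
rewrite -[X in _ - X]mul1r -(sum_bernoulli_weight t) [in leLHS]mulr_suml -sumrB.
apply: le_trans (ler_norm_sum _ _ _) _.
(* Trades the absolute value for the square, whose average is the variance. *)
have h z : `|z| <= z ^+ 2 / e + e.
  have [ze|/ltW ez] := leP `|z| e.
    by rewrite (le_trans ze)// lerDr divr_ge0 ?sqr_ge0// ltW.
  rewrite -[leLHS]addr0 lerD ?(ltW e0)// ler_pdivlMr// -real_normK ?num_real//.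
  by rewrite expr2 ler_wpM2l.
apply: (@le_trans _ _ (\sum_(S : {set C}) L * (bernoulli_weight t S *
    (\sum_(c in S) p c - a) ^+ 2 / e + bernoulli_weight t S * e))).
  apply: ler_sum => S _; rewrite -mulrBr normrM.
  have w0 := bernoulli_weight_ge0 S t01.
  rewrite ger0_norm// -mulrA -mulrDr mulrCA ler_wpM2l//.
  apply: le_trans (lip _ _ (Y01 S) _) _; first by rewrite a0.
  by rewrite ler_wpM2l.
rewrite -mulr_sumr ler_wpM2l// big_split/= -!mulr_suml sum_bernoulli_weight.
rewrite mul1r lerD2r ler_wpM2r ?invr_ge0 ?(ltW e0)// bernoulli_variance.
rewrite ler_piMl ?sumr_ge0// => [c _|]; first exact: sqr_ge0.
by rewrite -[leRHS]mulr1 ler_pM//; lra.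
Qed.

End bernoulli_subsets.

(** * Cells of a separating sequence *)

Section cells.
Context d (T : measurableType d) (B : nat -> set T).
Hypothesis sepB : separating B.

(** The index of the atom containing x in the partition generated by the first l sets; these
    partitions refine as l grows. *)
Definition cell (l : nat) (x : T) : {ffun 'I_l -> bool} :=
  [ffun i : 'I_l => x \in B i].

Lemma measurable_cell1 l (c : {ffun 'I_l -> bool}) :
  measurable [set x | cell l x = c].
Proof.
have [mB _] := sepB.
rewrite (_ : [set x | _] = \bigcap_(i in [set: 'I_l])
    (if c i then B i else ~` B i)).
  apply: fin_bigcap_measurable => // i _; case: ifP => _; first exact: mB.
  exact: measurableC.
apply/seteqP; split => [x <- i _|x h /=].
  by rewrite ffunE; case: ifPn; rewrite ?inE ?notin_setE.
apply/ffunP => i; rewrite ffunE; have := h i I.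
by case: (c i) => ?; [apply/mem_set|apply/memNset].
Qed.

Lemma measurable_cell l (S : {set {ffun 'I_l -> bool}}) :
  measurable [set x | cell l x \in S].
Proof.
rewrite (_ : [set x | _] = \bigcup_(c in [set` S]) [set x | cell l x = c]).
  by apply: fin_bigcup_measurable => // c _; exact: measurable_cell1.
apply/seteqP; split => [x xS|x [c cS /= xc]].
  by exists (cell l x).
by rewrite xc.
Qed.

Lemma cell_separates (s : seq T) : exists L : nat,
  forall l, (L <= l)%N -> {in s &, injective (cell l)}.
Proof.
have [_ sB] := sepB.
have pair x y : exists L : nat, forall l, (L <= l)%N ->
    cell l x = cell l y -> x = y.
  have [->|xy] := eqVneq x y; first by exists 0%N.
  have [i hi] : exists i, (x \in B i) != (y \in B i).
    apply: contrapT => /forallNP h; move/eqP: xy; apply; apply: sB => i.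
    have /negP/negPn/eqP e := h i.
    by split => /mem_set q; apply/set_mem; [rewrite -e|rewrite e].
  exists i.+1 => l il /ffunP/(_ (Ordinal il)); rewrite !ffunE /= => e.
  by rewrite e eqxx in hi.
have row x (r : seq T) : exists L : nat, forall l, (L <= l)%N ->
    forall y, y \in r -> cell l x = cell l y -> x = y.
  elim: r => [|y r [L IH]]; first by exists 0%N.
  have [L' IH'] := pair x y; exists (maxn L L') => l.
  rewrite geq_max => /andP[Ll L'l] z; rewrite inE => /orP[/eqP ->|]; first exact: IH'.
  exact: IH.
elim: s => [|x s [L IH]]; first by exists 0%N.
have [L' IH'] := row x s; exists (maxn L L') => l.
rewrite geq_max => /andP[Ll L'l] y z; rewrite !inE.
move=> /orP[/eqP ->|ys] /orP[/eqP ->|zs]//; first exact: IH'.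
  by move/esym/(IH' _ L'l _ ys).
exact: IH.
Qed.

Context {R : realType} (H : probability T R).

Definition cell_mass l (c : {ffun 'I_l -> bool}) : R :=
  fine (H [set x | cell l x = c]).

Lemma cell_mass_ge0 l c : 0 <= @cell_mass l c.
Proof. exact: fine_ge0. Qed.

Lemma sum_cell_mass l (S : {set {ffun 'I_l -> bool}}) :
  \sum_(c in S) cell_mass c = fine (H [set x | cell l x \in S]).
Proof.
rewrite -big_enum/=; transitivity (\sum_(c <- enum S)
    \int[H]_x (\1_[set x | cell l x = c] x)).
  by apply: eq_bigr => c _; rewrite Rintegral_indic//; exact: measurable_cell1.
rewrite -Rintegral_sum => [|c]; last first.
  by apply: bounded_mfun_indic; exact: measurable_cell1.
rewrite -Rintegral_indic; last exact: measurable_cell.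
apply: eq_Rintegral => x _; rewrite big_enum/= indicE.
have [/set_mem/= xS|/negP xS] := boolP (x \in _).
  rewrite (bigD1 (cell l x))//= big1 ?addr0 => [|c /andP[_ cx]].
    by rewrite indicE mem_set.
  by rewrite indicE memNset//= => e; rewrite e eqxx in cx.
rewrite big1// => c cS; rewrite indicE memNset//= => e.
by apply: xS; apply: mem_set; rewrite /= e.
Qed.

Lemma sum_cell_mass1 l : \sum_c @cell_mass l c = 1.
Proof.
have := sum_cell_mass [set: {ffun 'I_l -> bool}]%SET.
rewrite (eq_bigl xpredT) => [->|c]; last by rewrite finset.in_setT.
rewrite [X in H X](_ : _ = setT) ?probability_setT//.
by apply/seteqP; split => // x _ /=; rewrite finset.in_setT.
Qed.

(** The sum of squares is the expected mass of the cell of a random point. Cells around a fixed x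
    decrease to {x}, which is null, and bounded convergence concludes. *)
Lemma sum_cell_mass_sqr_cvg0 : diffuse H ->
  \sum_(c : {ffun 'I_l -> bool}) cell_mass c ^+ 2 @[l --> \oo] --> (0 : R).
Proof.
move=> dH.
have pE l x : cell_mass (cell l x) = \sum_c cell_mass c *
    \1_[set x | cell l x = c] x.
  rewrite (bigD1 (cell l x))//= big1 ?addr0 => [|c cx].
    by rewrite indicE mem_set//= mulr1.
  by rewrite indicE memNset ?mulr0//= => e; rewrite e eqxx in cx.
have b1 l c : bounded_mfun (fun x => cell_mass c * \1_[set x | cell l x = c] x).
  apply: bounded_mfunM; first exact: bounded_mfun_cst.
  by apply: bounded_mfun_indic; exact: measurable_cell1.
have sE l : \sum_(c : {ffun 'I_l -> bool}) cell_mass c ^+ 2 =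
    \int[H]_x cell_mass (cell l x).
  under [RHS]eq_Rintegral do rewrite pE.
  rewrite Rintegral_sum//; apply: eq_bigr => c _.
  rewrite RintegralZl//; last first.
    by apply: bounded_mfun_integrable; apply: bounded_mfun_indic; exact: measurable_cell1.
  by rewrite Rintegral_indic; [rewrite expr2|exact: measurable_cell1].
under eq_fun do rewrite sE.
have -> : (0 : R) = \int[H]_x 0 by rewrite Rintegral_probability_cst.
apply: (@bounded_convergence _ _ _ _ _ _ 1) => //.
- move=> l; under eq_fun do rewrite pE.
  by apply: measurable_sum => c; have [] := b1 l c.
- move=> l x; rewrite ger0_norm ?cell_mass_ge0//.
  rewrite -lee_fin fineK ?fin_num_measure//; last exact: measurable_cell1.
  by apply: probability_le1; exact: measurable_cell1.
apply: aeW => x.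
pose F l := [set y | cell l y = cell l x].
have capF : \bigcap_l F l = [set x].
  apply/seteqP; split => [y h /=|y /= -> //].
  have [L /(_ L (leqnn L))] := cell_separates [:: x; y].
  by apply; rewrite ?inE ?eqxx ?orbT//; exact: h.
have cF : H (F l) @[l --> \oo] --> H (\bigcap_l F l).
  apply: nonincreasing_cvg_mu.
  - rewrite (le_lt_trans (probability_le1 H _)) ?ltry//; exact: measurable_cell1.
  - by move=> l; exact: measurable_cell1.
  - by rewrite capF; exact: separating_measurable1 sepB.
  - move=> l m lm; apply/subsetPset => y; rewrite /F/= => /ffunP e.
    apply/ffunP => i; have := e (widen_ord lm i).
    by rewrite !ffunE.
rewrite capF dH in cF.
exact: fine_cvg cF.
Qed.

End cells.

(** * Thinning a conditionally i.i.d. sample *)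

Lemma card_imset_undup (I : finType) (C : finType) (f : I -> C) (J : {set I}) :
  #|[set f i | i in J]%SET| = size (undup [seq f i | i <- enum J]).
Proof.
rewrite -(card_uniqP (undup_uniq _)); apply: eq_card => y.
rewrite mem_undup; apply/imsetP/mapP => -[i iJ ->]; exists i => //.
  by rewrite mem_enum.
by rewrite mem_enum in iJ.
Qed.

Lemma size_undup_map_in (C D : eqType) (f : C -> D) (s : seq C) :
  {in s &, injective f} -> size (undup (map f s)) = size (undup s).
Proof.
move=> inj; rewrite -(size_map f (undup s)); apply/perm_size/uniq_perm.
- exact: undup_uniq.
- rewrite map_inj_in_uniq ?undup_uniq// => x y.
  by rewrite !mem_undup; exact: inj.
by move=> y; rewrite mem_undup; apply/mapP/mapP => -[x xs ->]; exists x => //;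
  rewrite mem_undup in xs *.
Qed.

Section conditionally_iid_sample.
Context d d' (Omega : measurableType d) (T : measurableType d')
  (R : realType) (P : probability Omega R) (Q : {RV P >-> pprobability T R})
  (n : nat) (X : 'I_n -> {RV P >-> T}).
Hypothesis iid : conditionally_iid Q X.

Lemma measurable_pprobability_eval (A : set T) : measurable A ->
  measurable_fun setT (fun q : pprobability T R => (q : probability T R) A).
Proof.
move=> mA.
exact: (measurable_kernel (kprobability (@measurable_id _ (pprobability T R) setT))).
Qed.

Lemma two_set_event (I J : {set 'I_n}) (A A' : set T) : {in I, forall i, i \notin J} ->
  [set w | (forall i, i \in I -> A (X i w)) /\
           (forall i, i \in J -> A' (X i w))] =
  \bigcap_i (X i @^-1` (if i \in I then A else if i \in J then A' else setT)).
Proof.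
move=> IJ; apply/seteqP; split => [w [hI hJ] i _ /=|w h /=].
  by case: ifPn => [/hI//|_]; case: ifPn => [/hJ|].
split => i ij; have /= := h i Logic.I; first by rewrite ij.
by rewrite ij ifN//; apply: contraL ij; exact: IJ.
Qed.

Lemma measurable_two_set_event (I J : {set 'I_n}) (A A' : set T) :
  {in I, forall i, i \notin J} -> measurable A -> measurable A' ->
  measurable [set w | (forall i, i \in I -> A (X i w)) /\
                      (forall i, i \in J -> A' (X i w))].
Proof.
move=> IJ mA mA'; rewrite two_set_event//.
apply: fin_bigcap_measurable => // i _; apply: measurable_funPTI.
by case: ifP => // _; case: ifP.
Qed.

Lemma prob_two_set_event (I J : {set 'I_n}) (A A' : set T) :
  {in I, forall i, i \notin J} -> measurable A -> measurable A' ->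
  fine (P [set w | (forall i, i \in I -> A (X i w)) /\
                   (forall i, i \in J -> A' (X i w))]) =
  \int[P]_w (fine ((Q w : probability T R) A) ^+ #|I| *
             fine ((Q w : probability T R) A') ^+ #|J|).
Proof.
move=> IJ mA mA'; rewrite two_set_event//.
pose C (i : 'I_n) := if i \in I then A else if i \in J then A' else setT.
have mC i : measurable (C i) by rewrite /C; case: ifP => // _; case: ifP.
have := iid measurableT mC; rewrite preimage_setT setTI => ->.
rewrite /Rintegral; congr fine; apply: eq_integral => w _.
transitivity ((\prod_(i < n) fine ((Q w : probability T R) (C i)))%:E).
  elim/big_ind2 : _ => // [x1 x2 y1 y2 -> ->//|i _].
  by rewrite fineK ?fin_num_measure.
congr EFin; rewrite (bigID (mem I))/=; congr (_ * _).
  by rewrite -prodr_const; apply: eq_bigr => i iI; rewrite /C iI.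
rewrite (bigID (mem J))/= [X in _ * X]big1 ?mulr1 => [|i /andP[iI iJ]].
  rewrite -prodr_const; apply: eq_big => i.
    by case: (boolP (i \in J)) => iJ; rewrite ?andbF// andbT; apply: contraL iJ; exact: IJ.
  by move=> /andP[/negbTE iI iJ]; rewrite /C iI iJ.
by rewrite /C (negbTE iI) (negbTE iJ) probability_setT.
Qed.

Section thinning.
Context (x0 : T) (B : nat -> set T).
Hypothesis sepB : separating B.

Definition distinct_on (J : {set 'I_n}) (w : Omega) : nat :=
  size (undup [seq X i w | i <- enum J]).

Definition atom_event (I J : {set 'I_n}) : set Omega :=
  [set w | (forall i, i \in I -> X i w = x0) /\
           (forall i, i \in J -> X i w <> x0)].

Definition thinned l (S : {set {ffun 'I_l -> bool}}) : set T :=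
  [set x | x <> x0 /\ cell B l x \in S].

Lemma measurable_thinned l (S : {set {ffun 'I_l -> bool}}) :
  measurable (thinned S).
Proof.
rewrite (_ : thinned S = ~` [set x0] `&` [set x | cell B l x \in S])//.
apply: measurableI; last exact: measurable_cell.
by apply: measurableC; exact: separating_measurable1 sepB.
Qed.

Lemma distinct_on_le J w : (distinct_on J w <= n)%N.
Proof.
rewrite (leq_trans (size_undup _))// size_map -cardE.
by rewrite (leq_trans (max_card _))// card_ord.
Qed.

Lemma cells_hit_eventually (J : {set 'I_n}) w :
  \forall l \near \oo,
    #|[set cell B l (X i w) | i in J]%SET| = distinct_on J w.
Proof.
have [L hL] := cell_separates sepB [seq X i w | i <- enum J].
exists L => // l /= Ll; rewrite card_imset_undup map_comp.
by rewrite size_undup_map_in//; exact: hL.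
Qed.

(** The count is the pointwise limit of the number of cells hit, and each of these is a finite sum
    of indicators of measurable events. *)
Lemma measurable_distinct_on J k : measurable [set w | distinct_on J w = k].
Proof.
pose N l w : R := #|[set cell B l (X i w) | i in J]%SET|%:R.
have mN l : measurable_fun setT (N l).
  rewrite (_ : N l = fun w => \sum_(c : {ffun 'I_l -> bool})
      \1_(\bigcup_(i in [set` J]) X i @^-1` [set x | cell B l x = c]) w).
    apply: measurable_sum => c; apply: measurable_indic.
    apply: fin_bigcup_measurable => // i _; apply: measurable_funPTI.
    exact: measurable_cell1.
  apply/funext => w; rewrite /N -sum1_card natr_sum big_mkcond/=.
  apply: eq_bigr => c _; rewrite indicE.
  suff <- : (c \in [set cell B l (X i w) | i in J]%SET) =
      (w \in \bigcup_(i in [set` J]) X i @^-1` [set x | cell B l x = c]).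
    by case: ifP.
  apply/imsetP/idP => [[i iJ ->]|/set_mem[i iJ /= e]].
    by apply: mem_set; exists i.
  by exists i.
have mD : measurable_fun setT (fun w => (distinct_on J w)%:R : R).
  apply: (@measurable_fun_cvg _ _ _ _ N) => // w _.
  apply: cvg_near_cst; have := cells_hit_eventually J w.
  by apply: filterS => l; rewrite /N => ->.
rewrite (_ : [set w | _] = (fun w => (distinct_on J w)%:R : R) @^-1` [set k%:R]).
  by rewrite -[X in measurable X]setTI; apply: mD.
apply/seteqP; split => [w /= ->//|w /= /eqP].
by rewrite eqr_nat => /eqP.
Qed.

Lemma measurable_atom_event (I J : {set 'I_n}) :
  {in I, forall i, i \notin J} -> measurable (atom_event I J).
Proof.
move=> IJ; have m0 := separating_measurable1 x0 sepB.
exact: (@measurable_two_set_event I J [set x0] (~` [set x0]) IJ m0 (measurableC m0)).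
Qed.

(** Averaging over S inside the expectation replaces the events by t to the number of cells hit,
    which eventually equals the number of distinct values. The left side involves I and J only
    through their cardinalities, and this is what yields exchangeability later. *)
Lemma thinning_limit (I J : {set 'I_n}) t : 0 <= t <= 1 -> {in I, forall i, i \notin J} ->
  \sum_(S : {set {ffun 'I_l -> bool}}) bernoulli_weight t S *
     \int[P]_w (fine ((Q w : probability T R) [set x0]) ^+ #|I| *
                fine ((Q w : probability T R) (thinned S)) ^+ #|J|) @[l --> \oo]
  --> \sum_(k < n.+1) t ^+ k *
        fine (P (atom_event I J `&` [set w | distinct_on J w = k])).
Proof.
move=> t01 IJ; have m0 := separating_measurable1 x0 sepB.
have mE := measurable_atom_event IJ.
pose E l (S : {set {ffun 'I_l -> bool}}) :=
  [set w | (forall i, i \in I -> [set x0] (X i w)) /\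
           (forall i, i \in J -> thinned S (X i w))].
have mES l S : measurable (@E l S).
  by apply: measurable_two_set_event => //; exact: measurable_thinned.
(* The average over S of the indicators of [E l S]: when the atom constraints hold, the event says
   that S contains every cell hit. *)
pose G l w := \1_(atom_event I J) w *
  t ^+ #|[set cell B l (X i w) | i in J]%SET| : R.
have GE l w : G l w = \sum_(S : {set {ffun 'I_l -> bool}})
    bernoulli_weight t S * \1_(@E l S) w.
  rewrite /G indicE; have [/set_mem[wI wJ]|/negP wE] := boolP (w \in _).
    rewrite mul1r -sum_bernoulli_weight_sup; apply: eq_bigr => S _.
    rewrite indicE; congr (_ * (nat_of_bool _)%:R).
    apply/fintype.subsetP/idP => [h|/set_mem[_ h] _ /imsetP[i iJ ->]].
      apply: mem_set; split => // i iJ; split; first exact: wJ.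
      by apply: h; apply/imsetP; exists i.
    by have [] := h i iJ.
  rewrite mul0r big1// => S _; rewrite indicE memNset ?mulr0// => -[h1 h2].
  by apply: wE; apply: mem_set; split => // i /h2[].
have bterm l (S : {set {ffun 'I_l -> bool}}) :
    bounded_mfun (fun w => bernoulli_weight t S * \1_(@E l S) w : R).
  apply: bounded_mfunM; first exact: bounded_mfun_cst.
  exact: bounded_mfun_indic.
have intG l : \int[P]_w G l w = \sum_(S : {set {ffun 'I_l -> bool}})
    bernoulli_weight t S *
     \int[P]_w (fine ((Q w : probability T R) [set x0]) ^+ #|I| *
                fine ((Q w : probability T R) (thinned S)) ^+ #|J|).
  under eq_Rintegral do rewrite GE.
  rewrite Rintegral_sum//; apply: eq_bigr => S _; rewrite RintegralZl//; last first.
    by apply: bounded_mfun_integrable; exact: bounded_mfun_indic.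
  rewrite Rintegral_indic// prob_two_set_event//; exact: measurable_thinned.
under eq_fun do rewrite -intG.
pose Ek k := atom_event I J `&` [set w | distinct_on J w = k].
have mEk k : measurable (Ek k).
  by apply: measurableI => //; exact: measurable_distinct_on.
have bEk (k : nat) : bounded_mfun (fun w => t ^+ k * \1_(Ek k) w).
  apply: bounded_mfunM; first exact: bounded_mfun_cst.
  exact: bounded_mfun_indic.
have -> : \sum_(k < n.+1) t ^+ k * fine (P (Ek k)) =
    \int[P]_w (\1_(atom_event I J) w * t ^+ distinct_on J w).
  transitivity (\int[P]_w (\sum_(k < n.+1) t ^+ k * \1_(Ek k) w)).
    rewrite Rintegral_sum//; apply: eq_bigr => k _; rewrite RintegralZl//; last first.
      by apply: bounded_mfun_integrable; exact: bounded_mfun_indic.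
    by rewrite Rintegral_indic.
  apply: eq_Rintegral => w _.
  have kn : (distinct_on J w < n.+1)%N by rewrite ltnS distinct_on_le.
  rewrite (bigD1 (Ordinal kn))//= big1 ?addr0 => [|k].
    rewrite mulrC; congr (_ * _); rewrite !indicE; congr (nat_of_bool _)%:R.
    apply/idP/idP => /set_mem; first by move=> [h _]; apply: mem_set.
    by move=> h; apply: mem_set.
  rewrite -val_eqE/= => kw; rewrite indicE memNset ?mulr0// => -[_ /= e].
  by rewrite e eqxx in kw.
apply: (@bounded_convergence _ _ _ _ _ _ 1).
- move=> l; rewrite (funext (GE l)).
  by apply: measurable_sum => S; have [] := bterm l S.
- apply: measurable_funM; first exact: measurable_indic.
  (* The sequence is constant in l: the limit serves only to replace the function by an equal finite
     sum of indicators. *)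
  apply: (@measurable_fun_cvg _ _ _ _ (fun l w =>
    \sum_(k < n.+1) t ^+ k * \1_[set w | distinct_on J w = k] w)) => [_|w _].
    apply: measurable_sum => k; apply: measurable_funM => //.
    by apply: measurable_indic; exact: measurable_distinct_on.
  have kn : (distinct_on J w < n.+1)%N by rewrite ltnS distinct_on_le.
  rewrite (bigD1 (Ordinal kn))//= big1 ?addr0 => [|k].
    by rewrite indicE mem_set//= mulr1; exact: cvg_cst.
  rewrite -val_eqE/= => kw; rewrite indicE memNset ?mulr0// => /= e.
  by rewrite e eqxx in kw.
- move=> l w; have tX k : 0 <= t ^+ k <= 1.
    by move: t01 => /andP[t0 t1]; rewrite exprn_ge0//= exprn_ile1.
  have /andP[h1 h2] := tX #|[set cell B l (X i w) | i in J]%SET|.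
  rewrite /G indicE; case: (_ \in _); rewrite ?mul1r ?mul0r ?normr0//.
  by rewrite ger0_norm.
- apply: aeW => w; apply: cvg_near_cst; have := cells_hit_eventually J w.
  by apply: filterS => l; rewrite /G => ->.
Qed.

End thinning.
End conditionally_iid_sample.

(** * Generating function of the number of distinct values *)

Lemma poly_eq_on_unit_interval (R : realFieldType) (N : nat) (a b : nat -> R) :
  (forall t : R, 0 <= t <= 1 ->
     \sum_(k < N) t ^+ k * a k = \sum_(k < N) t ^+ k * b k) ->
  forall k, (k < N)%N -> a k = b k.
Proof.
move=> ab k kN; apply/eqP; rewrite -subr_eq0.
pose p := \poly_(k < N) (a k - b k).
have -> : a k - b k = p`_k by rewrite coef_poly kN.
suff -> : p = 0 by rewrite coef0.
apply/eqP/negPn/negP => p0.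
(* N distinct points of the unit interval, too many roots for a nonzero polynomial with N
   coefficients. *)
pose rs : seq R := [seq i.+1%:R^-1 | i <- iota 0 N].
have rs_root : all (root p) rs.
  apply/allP => _ /mapP[i _ ->]; rewrite rootE horner_poly; apply/eqP.
  have i01 : 0 <= (i.+1%:R^-1 : R) <= 1.
    by rewrite invr_ge0 ler0n/= invf_le1 ?ltr0n// ler1n.
  under eq_bigr do rewrite mulrC mulrBr.
  by rewrite sumrB ab// subrr.
have rs_uniq : uniq rs.
  rewrite map_inj_uniq ?iota_uniq// => i j /invr_inj/eqP.
  by rewrite eqr_nat => /eqP[].
have := max_poly_roots p0 rs_root rs_uniq.
rewrite size_map size_iota ltnNge.
by rewrite (leq_trans (size_poly _ _)).
Qed.

Section hNRMI.
Context (R : realType) (rho : R -> R) (c : R).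

(** The random measure behind the law lives on its own probability space, so moments pass through
    the image measure that both spaces induce on probability measures. *)
Lemma hNRMI_CRM_moment d d' (Omega : measurableType d) (T : measurableType d')
    (P : probability Omega R) (Q : {RV P >-> pprobability T R})
    (H : probability T R) :
  is_hNRMI rho c H (distribution P Q) ->
  exists (d2 : measure_display) (Omega2 : measurableType d2)
    (P2 : probability Omega2 R) (mu2 : R.-ker Omega2 ~> T),
    CRM_with_intensity P2 mu2 rho c H /\
    forall (A : set T) m, measurable A ->
      \int[P]_w fine ((Q w : probability T R) A) ^+ m =
      \int[P2]_w fine (mnormalize (mu2 w) H A) ^+ m.
Proof.
case=> d2 [] Omega2 [] P2 [] mu2 [] crm LE.
exists d2, Omega2, P2, mu2; split => // A m mA.
pose g w : pprobability T R := mnormalize (mu2 w) H.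
(* It suffices to test the generating sets, where an evaluation is compared with a threshold. *)
have mg : measurable_fun setT g.
  apply: (measurability (@pset _ _ _ : set (set (pprobability T R)))) => //.
  move=> _ -[_ [r r01] [Y mY <-]] <-.
  apply: emeasurable_fun_infty_o => //.
  exact: (measurable_kernel (knormalize mu2 H)).
pose g' : {mfun Omega2 >-> pprobability T R} :=
  HB.pack g (isMeasurableFun.Build _ _ _ _ g mg).
pose phi (q : pprobability T R) : \bar R :=
  (fine ((q : probability T R) A) ^+ m)%:E.
have mphi : measurable_fun setT phi.
  apply/measurable_EFinP; apply: measurable_funX; apply: measurableT_comp => //.
  exact: measurable_pprobability_eval.
have phi0 q : (0 <= phi q)%E by rewrite lee_fin exprn_ge0// fine_ge0.
rewrite /Rintegral; congr fine.
transitivity (\int[distribution P Q]_q phi q)%E.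
  by rewrite ge0_integral_distribution.
transitivity (\int[distribution P2 g']_q phi q)%E.
  by apply: eq_measure_integral => D mD _; exact: LE.
by rewrite ge0_integral_distribution.
Qed.

Section generating_function.
Context d' (T : measurableType d') (B : nat -> set T) (x0 : T)
  (Pstar : probability T R).
Hypothesis sepB : separating B.
Hypothesis diffP : diffuse Pstar.
Variable F : nat -> R -> R.
Hypothesis F_lip : forall m p q, 0 <= p -> p <= q -> q <= 1 ->
  0 <= F m q - F m p <= m%:R * (q - p).
Context d (Omega : measurableType d) (P : probability Omega R)
  (Q : {RV P >-> pprobability T R}) (n : nat) (X : 'I_n -> {RV P >-> T})
  (H : probability T R) (beta : R).
Hypothesis iid : conditionally_iid Q X.
Hypothesis F_moment : forall (A : set T) m, measurable A ->
  \int[P]_w fine ((Q w : probability T R) A) ^+ m = F m (fine (H A)).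
Hypothesis beta01 : 0 <= beta <= 1.
Hypothesis HE : forall A, measurable A -> ~ A x0 ->
  fine (H A) = beta * fine (Pstar A).

Lemma mass_thinned l (S : {set {ffun 'I_l -> bool}}) :
  fine (H (thinned x0 B S)) = \sum_(c in S) beta * cell_mass B Pstar c.
Proof.
rewrite HE; [|exact: measurable_thinned|by case].
rewrite -mulr_sumr sum_cell_mass//; congr (_ * fine _).
have m1 := separating_measurable1 x0 sepB.
have -> : thinned x0 B S = [set x | cell B l x \in S] `\` [set x0].
  by apply/seteqP; split => x /= [].
rewrite measureD//; last 2 first.
- exact: measurable_cell.
- rewrite (le_lt_trans (probability_le1 Pstar _)) ?ltry//; exact: measurable_cell.
rewrite [X in (_ - X)%E](_ : _ = 0%E) ?sube0//.
apply/eqP; rewrite eq_le measure_ge0 andbT -(diffP x0).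
apply: le_measure; rewrite ?inE//.
by apply: measurableI => //; exact: measurable_cell.
Qed.

(** The thinned averages have a second limit: kept base mass concentrates at t beta and [F] is
    Lipschitz. Used with beta = 1 - zeta for the model with an atom and beta = 1 for the diffuse
    one. *)
Lemma distinct_generating_function (J : {set 'I_n}) t : 0 <= t <= 1 ->
  \sum_(k < n.+1) t ^+ k *
    fine (P (atom_event X x0 finset.set0 J `&` [set w | distinct_on X J w = k])) =
  F #|J| (t * beta).
Proof.
move=> t01.
have disj : {in finset.set0, forall i : 'I_n, i \notin J}.
  by move=> i; rewrite finset.in_set0.
have lim := thinning_limit (x0 := x0) iid sepB t01 disj.
apply: (cvg_unique _ lim) => //.
pose s l := \sum_(c : {ffun 'I_l -> bool}) (beta * cell_mass B Pstar c) ^+ 2.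
have s0 : s l @[l --> \oo] --> (0 : R).
  have -> : s = fun l => beta ^+ 2 *
      \sum_(c : {ffun 'I_l -> bool}) cell_mass B Pstar c ^+ 2.
    apply/funext => l; rewrite /s mulr_sumr.
    by apply: eq_bigr => c' _; rewrite exprMn.
  rewrite -[X in _ --> X](mulr0 (beta ^+ 2)); apply: cvgMl_tmp.
  exact: sum_cell_mass_sqr_cvg0.
set L : R := #|J|%:R.
have L0 : 0 <= L by rewrite ler0n.
have approx l e : 0 < e ->
  `|\sum_(S : {set {ffun 'I_l -> bool}}) bernoulli_weight t S *
     \int[P]_w (fine ((Q w : probability T R) [set x0]) ^+ #|(finset.set0 : {set 'I_n})| *
                fine ((Q w : probability T R) (thinned x0 B S)) ^+ #|J|) -
    F #|J| (t * beta)| <= L * (s l / e + e).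
  move=> e0.
  have sp : \sum_(c : {ffun 'I_l -> bool}) beta * cell_mass B Pstar c = beta.
    by rewrite -mulr_sumr sum_cell_mass1// mulr1.
  have p0 (c' : {ffun 'I_l -> bool}) : 0 <= beta * cell_mass B Pstar c'.
    apply: mulr_ge0; last exact: cell_mass_ge0.
    by have /andP[] := beta01.
  have sp1 : \sum_(c : {ffun 'I_l -> bool}) beta * cell_mass B Pstar c <= 1.
    by rewrite sp; have /andP[] := beta01.
  have := bernoulli_lipschitz_approx t01 p0 sp1 e0 L0 (F_lip #|J|).
  rewrite sp; congr (`|_ - _| <= _); apply: eq_bigr => S _; congr (_ * _).
  rewrite -mass_thinned -F_moment; last exact: measurable_thinned.
  by apply: eq_Rintegral => w _; rewrite cards0 expr0 mul1r.
apply/cvgrPdist_le => e e0.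
(* Once s l <= e1^2, both terms of the bound are at most e1, and 2 L e1 <= e. The added 1 keeps the
   denominator positive when J is empty. *)
pose e1 := e / (2 * (L + 1)).
have L1 : 0 < 2 * (L + 1) by rewrite mulr_gt0// ltr_wpDl.
have e10 : 0 < e1 by rewrite divr_gt0.
have : \forall l \near \oo, s l <= e1 ^+ 2.
  move/cvgrPdist_le : s0 => /(_ _ (exprn_gt0 2 e10)); apply: filterS => l.
  rewrite sub0r normrN; apply: le_trans; exact: ler_norm.
apply: filterS => l sl; rewrite distrC; apply: le_trans (approx l e1 e10) _.
have : s l / e1 <= e1 by rewrite ler_pdivrMr// -expr2.
have eE : e = e1 * (2 * (L + 1)) by rewrite /e1 divfK// gt_eqF.
move=> h; rewrite eE; nra.
Qed.

End generating_function.

(** Both generating functions are limits of the same sequence, hence agree on the unit interval, and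
    so do their coefficients. *)
Lemma atom_event_exchangeable d d' (Omega : measurableType d)
    (T : measurableType d') (P : probability Omega R)
    (Q : {RV P >-> pprobability T R}) (n : nat) (X : 'I_n -> {RV P >-> T})
    (B : nat -> set T) (x0 : T) (I J I' J' : {set 'I_n}) (k : nat) :
  separating B -> conditionally_iid Q X ->
  {in I, forall i, i \notin J} -> {in I', forall i, i \notin J'} ->
  #|I| = #|I'| -> #|J| = #|J'| -> (k <= n)%N ->
  fine (P (atom_event X x0 I J `&` [set w | distinct_on X J w = k])) =
  fine (P (atom_event X x0 I' J' `&` [set w | distinct_on X J' w = k])).
Proof.
move=> sepB iid IJ IJ' cI cJ kn.
pose a (I J : {set 'I_n}) k :=
  fine (P (atom_event X x0 I J `&` [set w | distinct_on X J w = k])).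
rewrite -/(a I J k) -/(a I' J' k).
apply: (@poly_eq_on_unit_interval R n.+1) => // t t01.
have h1 := thinning_limit (x0 := x0) iid sepB t01 IJ.
have h2 := thinning_limit (x0 := x0) iid sepB t01 IJ'.
rewrite cI cJ in h1.
exact: (cvg_unique _ h1 h2).
Qed.

End hNRMI.

(** * Decomposition by the observations equal to the atom *)

Section first_indices.
Context {n : nat}.

Definition first_indices (m : nat) : {set 'I_n} := [set i : 'I_n | (i < m)%N]%SET.

Lemma card_first_indices m : (m <= n)%N -> #|first_indices m| = m.
Proof.
move=> mn; rewrite /first_indices cardsE cardE -(size_map val) -[RHS](size_iota 0).
apply/perm_size/uniq_perm.
- by rewrite map_inj_uniq ?enum_uniq//; exact: val_inj.
- exact: iota_uniq.
move=> j; rewrite mem_iota add0n /=; apply/mapP/idP => [[i]|jm].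
  by rewrite mem_enum => im ->.
by exists (Ordinal (leq_trans jm mn)) => //; rewrite mem_enum.
Qed.

Lemma first_indicesT : first_indices n = [set: 'I_n]%SET.
Proof. by apply/setP => i; rewrite !finset.inE ltn_ord. Qed.

End first_indices.

Section distinct_values_facts.
Context d d' (Omega : measurableType d) (T : measurableType d')
  (R : realType) (P : probability Omega R) (n : nat) (X : 'I_n -> {RV P >-> T}).

Lemma distinct_valuesE m w :
  distinct_values (fun i => X i : Omega -> T) m w =
  distinct_on X (first_indices m) w.
Proof.
rewrite /distinct_values /distinct_on; congr (size (undup (map _ _))).
rewrite [in RHS]/enum_mem [in LHS]/enum_mem -filter_predI.
by apply: eq_filter => i /=; rewrite !inE andbT.
Qed.

Lemma distinct_on_split (x0 : T) (I : {set 'I_n}) w :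
  I != finset.set0 -> atom_event X x0 I (~: I)%SET w ->
  distinct_on X [set: 'I_n]%SET w = (distinct_on X (~: I)%SET w).+1.
Proof.
move=> /set0Pn[i0 i0I] [hI hJ]; rewrite /distinct_on.
set s := [seq _ | i <- enum (~: I)%SET].
have x0s : x0 \notin s.
  by apply/negP => /mapP[i]; rewrite mem_enum => iJ /esym; exact: hJ.
have -> : (size (undup s)).+1 = size (undup (x0 :: s)) by rewrite /= ifN.
apply/perm_size/uniq_perm; rewrite ?undup_uniq// => y.
rewrite !mem_undup inE; apply/mapP/orP => [[i _ ->]|[/eqP ->|/mapP[i _ ->]]].
- have [iI|iI] := boolP (i \in I); [left|right]; first by rewrite hI.
  by apply/mapP; exists i => //; rewrite mem_enum finset.inE.
- by exists i0; rewrite ?mem_enum ?finset.in_setT ?hI.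
- by exists i => //; rewrite mem_enum finset.in_setT.
Qed.

End distinct_values_facts.

Lemma prob_setI_full d (Omega : measurableType d) (R : realType)
    (P : probability Omega R) (A E : set Omega) :
  measurable A -> measurable E -> fine (P E) = 1 ->
  fine (P (E `&` A)) = fine (P A).
Proof.
move=> mA mE PE.
have PEc : P (~` E) = 0%E.
  by rewrite probability_setC// -[P E]fineK ?fin_num_measure// PE subee.
have PD : P (A `\` E) = 0%E.
  apply/eqP; rewrite eq_le measure_ge0 andbT -PEc.
  by apply: le_measure; rewrite ?inE; [exact: measurableD|exact: measurableC|
    move=> w []].
by rewrite (measureDI P mA mE) [X in fine (X + _)%E]PD add0e setIC.
Qed.

Section decomposition.
Context d d' (Omega : measurableType d) (T : measurableType d')
  (R : realType) (P : probability Omega R) (Q : {RV P >-> pprobability T R})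
  (n : nat) (X : 'I_n -> {RV P >-> T}) (x0 : T) (B : nat -> set T).
Hypothesis sepB : separating B.
Hypothesis iid : conditionally_iid Q X.

Let V (I J : {set 'I_n}) (k : nat) :=
  fine (P (atom_event X x0 I J `&` [set w | distinct_on X J w = k])).

(** The event is partitioned by the exact set I of indices at the atom. A nonempty I uses one value
    for the atom and leaves k - 1 to the others; by exchangeability each of the binomially many sets
    of size r may be replaced by the last r indices. *)
Lemma prob_distinct_decomposition k : (1 <= k)%N -> (k <= n)%N ->
  fine (P [set w | distinct_on X [set: 'I_n]%SET w = k]) =
  V finset.set0 [set: 'I_n]%SET k +
  \sum_(1 <= r < (n - k + 1).+1)
    'C(n, r)%:R * V (~: first_indices (n - r))%SET (first_indices (n - r)) (k - 1)%N.
Proof.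
move=> k1 kn.
pose E := [set w | distinct_on X [set: 'I_n]%SET w = k].
have disjC (I : {set 'I_n}) : {in I, forall i, i \notin (~: I)%SET}.
  by move=> i; rewrite finset.in_setC negbK.
pose W (I : {set 'I_n}) := fine (P (atom_event X x0 I (~: I)%SET `&` E)).
have mE : measurable E by exact: (measurable_distinct_on X sepB).
have mW (I : {set 'I_n}) : measurable (atom_event X x0 I (~: I)%SET `&` E).
  by apply: measurableI => //; exact: (measurable_atom_event X x0 sepB (disjC I)).
have sumW : fine (P E) = \sum_(I : {set 'I_n}) W I.
  rewrite -Rintegral_indic//.
  transitivity (\int[P]_w \sum_(I : {set 'I_n})
      \1_(atom_event X x0 I (~: I)%SET `&` E) w); last first.
    rewrite Rintegral_sum => [|I]; last exact: bounded_mfun_indic.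
    by apply: eq_bigr => I _; rewrite Rintegral_indic.
  apply: eq_Rintegral => w _.
  (* The only index set whose indicator can be nonzero at w. *)
  pose Iw := [set i | X i w == x0]%SET.
  rewrite (bigD1 Iw)//= big1 ?addr0 => [|I IIw].
    rewrite !indicE; congr (nat_of_bool _)%:R.
    apply/idP/idP => /set_mem wE; apply: mem_set; last by case: wE.
    by split => //; split => i; rewrite !finset.inE => /eqP.
  rewrite indicE memNset// => -[[hI hJ] _]; move/eqP: IIw; apply.
  apply/setP => i; rewrite finset.inE; apply/idP/eqP => [/hI//|h].
  by apply/negPn/negP => iI; apply: (hJ i) => //; rewrite finset.in_setC.
have W0 : W finset.set0 = V finset.set0 [set: 'I_n]%SET k.
  by rewrite /W /V finset.setC0.
have WV (I : {set 'I_n}) : I != finset.set0 -> W I = V I (~: I)%SET (k - 1)%N.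
  move=> I0; rewrite /W /V; congr (fine (P _)).
  apply/seteqP; split => w [wA]; rewrite /E /= (distinct_on_split I0 wA) => e;
    by split => //=; lia.
have cardn (I : {set 'I_n}) : (#|I| < n.+1)%N.
  by rewrite ltnS -[leqRHS]card_ord max_card.
have cardC (I : {set 'I_n}) : #|(~: I)%SET| = (n - #|I|)%N.
  by rewrite cardsCs finset.setCK card_ord.
have Vr (I : {set 'I_n}) : V I (~: I)%SET (k - 1)%N =
    V (~: first_indices (n - #|I|))%SET (first_indices (n - #|I|)) (k - 1)%N.
  have cn : (#|I| <= n)%N by exact: cardn.
  apply: (atom_event_exchangeable x0 sepB iid).
  - exact: disjC.
  - by move=> i; rewrite finset.in_setC.
  - by rewrite cardC card_first_indices ?leq_subr// subKn.
  - by rewrite cardC card_first_indices// leq_subr.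
  - lia.
rewrite -/E sumW (bigD1 finset.set0)//= W0; congr (_ + _).
transitivity (\sum_(1 <= r < n.+1)
    'C(n, r)%:R * V (~: first_indices (n - r))%SET (first_indices (n - r)) (k - 1)%N).
  rewrite (partition_big (fun I : {set 'I_n} => inord #|I| : 'I_n.+1)
    (fun r : 'I_n.+1 => (0 < r)%N)) => [|I I0]; last first.
    by rewrite inordK ?card_gt0 ?cardn.
  rewrite big_add1/= [RHS]big_mkord [LHS]big_mkcond big_ord_recl/= add0r.
  apply: eq_bigr => r _.
  have cardr (I : {set 'I_n}) :
      (inord #|I| == lift ord0 r :> 'I_n.+1) = (#|I| == r.+1).
    by rewrite -val_eqE /= inordK ?cardn.
  transitivity (\sum_(I in [set I : {set 'I_n} | #|I| == r.+1]%SET)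
     V (~: first_indices (n - r.+1))%SET (first_indices (n - r.+1)) (k - 1)%N).
    apply: eq_big => I; rewrite cardr ?finset.inE -?card_gt0.
      by case: eqP => [->|]; rewrite ?andbF.
    by move=> /andP[I0 /eqP cI]; rewrite WV -?card_gt0// Vr cI.
  by rewrite sumr_const card_draws card_ord mulr_natl.
(* Beyond r = n - k + 1 fewer than k - 1 observations are left off the atom, so the event is
   empty. *)
rewrite (big_cat_nat (n := (n - k + 1).+1))//=; [|lia..].
rewrite [X in _ + X]big1_seq ?addr0// => r /andP[_]; rewrite mem_index_iota => /andP[r1 r2].
rewrite /V [X in P X](_ : _ = set0) ?measure0 ?mulr0//.
apply/seteqP; split => // w [_ /=] e.
have := size_undup [seq X i w | i <- enum (first_indices (n - r))].
rewrite -/(distinct_on X (first_indices (n - r)) w) e size_map -cardE.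
by rewrite card_first_indices; lia.
Qed.

(** When the first n - r observations avoid the atom, hitting it exactly r times means that all the
    last r observations hit it: the index set at the atom is contained in the last r indices and has
    as many elements. *)
Lemma atom_event_conditional r k : (1 <= r)%N -> (r <= n)%N ->
  V (~: first_indices (n - r))%SET (first_indices (n - r)) k =
  V finset.set0 (first_indices (n - r)) k *
  cond_prob P [set w | count_at (fun i => X i : Omega -> T) x0 w = r]
    [set w | distinct_on X (first_indices (n - r)) w = k /\
             forall i : 'I_n, (i < n - r)%N -> X i w <> x0].
Proof.
move=> r1 rn; rewrite /cond_prob /prob.
set N := [set w | _ = r]; set C := [set w | _ /\ _].
have CE : C = atom_event X x0 finset.set0 (first_indices (n - r)) `&`
    [set w | distinct_on X (first_indices (n - r)) w = k].
  apply/seteqP; split => w /=.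
    by move=> [h1 h2]; split => //; split => i; rewrite finset.inE//; exact: h2.
  move=> [[_ h1] h2]; split => // i ir; apply: h1; by rewrite finset.inE.
have cI : #|(~: first_indices (n - r) : {set 'I_n})%SET| = r.
  by rewrite cardsCs finset.setCK card_first_indices ?leq_subr// card_ord subKn.
have NC : N `&` C = atom_event X x0 (~: first_indices (n - r))%SET
    (first_indices (n - r)) `&`
    [set w | distinct_on X (first_indices (n - r)) w = k].
  rewrite CE; apply/seteqP; split => w.
    move=> [Nw [[_ hJ] hk]]; split => //; split => //.
    pose Iw := [set i | X i w == x0]%SET.
    have sub : Iw \subset (~: first_indices (n - r))%SET.
      apply/fintype.subsetP => i; rewrite finset.inE finset.in_setC => /eqP Xi.
      by apply/negP => /hJ.
    have eqI : Iw == (~: first_indices (n - r))%SET.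
      rewrite eqEcard sub cI -[X in (X <= _)%N]Nw /=.
      apply/eq_leq/eq_card => i.
      by rewrite !finset.inE.
    by move=> i; rewrite -(eqP eqI) finset.inE => /eqP.
  move=> [[hI hJ] hk]; split; last by split => //; split => // i; rewrite finset.inE.
  rewrite /N /= /count_at -[RHS]cI; apply: eq_card => i.
  rewrite finset.in_setC [LHS]inE; apply/eqP/idP => [Xi|iI].
    by apply/negP => iJ; exact: hJ iJ Xi.
  by apply: hI; rewrite finset.in_setC.
rewrite NC CE -/(V _ _ _) -/(V finset.set0 _ _).
(* If the conditioning event is null the quotient is 0 by convention, and the left side, the
   probability of a smaller event, vanishes as well. *)
have [V0|V0] := eqVneq (V finset.set0 (first_indices (n - r)) k) 0; last first.
  by rewrite mulrC divfK.
rewrite V0 mul0r; apply/eqP; rewrite eq_le fine_ge0// andbT -V0.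
have disj0 : {in finset.set0, forall i : 'I_n, i \notin first_indices (n - r)}.
  by move=> i; rewrite finset.in_set0.
have disjC : {in (~: first_indices (n - r))%SET, forall i : 'I_n,
    i \notin first_indices (n - r)}.
  by move=> i; rewrite finset.in_setC.
have mD := measurable_distinct_on X sepB (first_indices (n - r)) k.
have m1 : measurable (atom_event X x0 (~: first_indices (n - r))%SET
    (first_indices (n - r)) `&` [set w | distinct_on X (first_indices (n - r)) w = k]).
  by apply: measurableI => //; exact: (measurable_atom_event X x0 sepB disjC).
have m2 : measurable (atom_event X x0 finset.set0
    (first_indices (n - r)) `&` [set w | distinct_on X (first_indices (n - r)) w = k]).
  by apply: measurableI => //; exact: (measurable_atom_event X x0 sepB disj0).
rewrite fine_le ?fin_num_measure//; apply: le_measure; rewrite ?inE//.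
by move=> w [[_ h1] h2]; split => //; split => // i; rewrite finset.inE.
Qed.

End decomposition.

(** * Comparison of the model with an atom and the diffuse model *)

Section atom_and_diffuse_models.
Context (R : realType) (rho : R -> R) (c : R).
Hypothesis rho_meas : measurable_fun (`]0, +oo[ : set R) rho.
Hypothesis rho_ge0 : forall s : R, 0 < s -> 0 <= rho s.
Hypothesis rho_infinite : (\int[lebesgue_measure]_(s in `]0%R, +oo[)
                       (rho s)%:E = +oo)%E.
Hypothesis c_gt0 : 0 < c.
Context d0 (T : measurableType d0) (B : nat -> set T) (x0 : T)
  (Pstar : probability T R).
Hypothesis sepB : separating B.
Hypothesis diffP : diffuse Pstar.
Variable n : nat.
Context d (Omega : measurableType d) (P : probability Omega R)
  (Q : {RV P >-> pprobability T R}) (X : 'I_n -> {RV P >-> T})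
  (H : probability T R) (beta : R).
Hypothesis model : hNRMI_sample Q X rho c H.
Hypothesis beta01 : 0 <= beta <= 1.
Hypothesis HE : forall A, measurable A -> ~ A x0 ->
  fine (H A) = beta * fine (Pstar A).
Context d' (Omega' : measurableType d') (P' : probability Omega' R)
  (Q' : {RV P' >-> pprobability T R}) (X' : 'I_n -> {RV P' >-> T}).
Hypothesis model' : hNRMI_sample Q' X' rho c Pstar.

(** The generating function of the first model at t and that of the diffuse model at t beta are both
    F(t beta); the factor beta^k is read off the coefficients. *)
Lemma prob_distinct_avoiding_atom (J : {set 'I_n}) k : (k <= n)%N ->
  fine (P (atom_event X x0 finset.set0 J `&` [set w | distinct_on X J w = k])) =
  beta ^+ k * fine (P' [set w | distinct_on X' J w = k]).
Proof.
move=> kn; have [mod iid] := model; have [mod' iid'] := model'.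
have := hNRMI_CRM_moment mod; move=> [d2 [] Omega2 [] P2 [] mu2 [] crm mom].
have := hNRMI_CRM_moment mod'; move=> [d3 [] Omega3 [] P3 [] mu3 [] crm' mom'].
have [F [F_lip F1 F_CRM]] := normalized_CRM_moment_function
  rho_meas rho_ge0 rho_infinite c_gt0 crm' sepB diffP.
have F_mom (A : set T) m : measurable A ->
    \int[P]_w fine ((Q w : probability T R) A) ^+ m = F m (fine (H A)).
  by move=> mA; rewrite mom// (F_CRM _ _ _ _ _ _ _ _ _ crm).
have F_mom' (A : set T) m : measurable A ->
    \int[P']_w fine ((Q' w : probability T R) A) ^+ m = F m (fine (Pstar A)).
  by move=> mA; rewrite mom'// (F_CRM _ _ _ _ _ _ _ _ _ crm').
have disj0 : {in finset.set0, forall i : 'I_n, i \notin J}.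
  by move=> i; rewrite finset.in_set0.
have m0 := separating_measurable1 x0 sepB.
(* Under a diffuse base measure the atom is almost surely never observed: the base mass of its
   complement is 1 and F(1) = 1. *)
have avoid : fine (P' (atom_event X' x0 finset.set0 J)) = 1.
  have := prob_two_set_event iid' disj0 m0 (measurableC m0).
  rewrite -/(atom_event X' x0 finset.set0 J) => ->.
  rewrite -(F1 #|J|); have Pc : fine (Pstar (~` [set x0])) = 1.
    by rewrite probability_setC// diffP sube0.
  rewrite -Pc -F_mom'; last exact: measurableC.
  by apply: eq_Rintegral => w _; rewrite cards0 expr0 mul1r.
have one01 : 0 <= (1 : R) <= 1 by rewrite ler01 lexx.
have HE1 A : measurable A -> ~ A x0 -> fine (Pstar A) = 1 * fine (Pstar A).
  by rewrite mul1r.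
have <- : fine (P' (atom_event X' x0 finset.set0 J `&`
    [set w | distinct_on X' J w = k])) = fine (P' [set w | distinct_on X' J w = k]).
  apply: prob_setI_full => //; first exact: (measurable_distinct_on X' sepB).
  exact: (measurable_atom_event X' x0 sepB disj0).
pose a k := fine (P (atom_event X x0 finset.set0 J `&`
  [set w | distinct_on X J w = k])).
pose b k := fine (P' (atom_event X' x0 finset.set0 J `&`
  [set w | distinct_on X' J w = k])).
rewrite -/(a k) -/(b k).
apply: (@poly_eq_on_unit_interval R n.+1 a (fun k => beta ^+ k * b k)) => // t t01.
have tb01 : 0 <= t * beta <= 1.
  move: t01 beta01 => /andP[t0 t1] /andP[b0 b1].
  by rewrite mulr_ge0//= -[leRHS]mulr1 ler_pM.
rewrite (distinct_generating_function (x0 := x0) sepB diffP F_lip iid F_mom beta01 HE J t01).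
have := distinct_generating_function (x0 := x0) sepB diffP F_lip iid' F_mom' one01 HE1 J tb01.
rewrite mulr1 => <-; apply: eq_bigr => j _.
by rewrite exprMn mulrA.
Qed.

Theorem prob_distinct_atom_mixture (k : nat) : (1 <= k)%N -> (k <= n)%N ->
  let K := distinct_values (fun i => X i : Omega -> T) in
  let K' := distinct_values (fun i => X' i : Omega' -> T) in
  let N0 := count_at (fun i => X i : Omega -> T) x0 in
  prob P [set w | K n w = k] =
    beta ^+ k * prob P' [set w | K' n w = k] +
    beta ^+ (k - 1) *
      \sum_(1 <= r < (n - k + 1).+1)
        'C(n, r)%:R * prob P' [set w | K' (n - r)%N w = (k - 1)%N] *
        cond_prob P [set w | N0 w = r]
          [set w | K (n - r)%N w = (k - 1)%N /\
                   forall i : 'I_n, (i < n - r)%N -> X i w <> x0].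
Proof.
move=> k1 kn K K' N0; have [_ iid] := model.
have KE m : K m = distinct_on X (first_indices m).
  by apply/funext => w; exact: distinct_valuesE.
have K'E m : K' m = distinct_on X' (first_indices m).
  by apply/funext => w; exact: distinct_valuesE.
rewrite /prob KE K'E first_indicesT (prob_distinct_decomposition x0 sepB iid)//.
rewrite prob_distinct_avoiding_atom//; congr (_ + _).
rewrite mulr_sumr [LHS]big_nat_cond [RHS]big_nat_cond.
apply: eq_bigr => r /andP[/andP[r1 r2] _].
rewrite (atom_event_conditional X x0 sepB)//; last by lia.
rewrite prob_distinct_avoiding_atom; last by lia.
by rewrite KE K'E; ring.
Qed.

End atom_and_diffuse_models.

Theorem theorem2 (R : realType) (T : ptopologicalType) (polishT : polish R T)
    (rho : R -> R)
    (rho_meas : measurable_fun (`]0, +oo[ : set R) rho)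
    (rho_ge0 : forall s : R, 0 < s -> 0 <= rho s)
    (rho_levy : (\int[lebesgue_measure]_(s in `]0%R, +oo[)
                   (Num.min 1 s * rho s)%:E < +oo)%E)
    (rho_infinite : (\int[lebesgue_measure]_(s in `]0%R, +oo[)
                       (rho s)%:E = +oo)%E)
    (rho_sums : sum_law_depends_on_total rho)
    (zeta c : R) (zeta_gt0 : 0 < zeta) (zeta_lt1 : zeta < 1) (c_gt0 : 0 < c)
    (x0 : T) (Pstar P0 : probability (borel T) R)
    (Pstar_diffuse : diffuse Pstar)
    (P0E : forall A : set (borel T), measurable A ->
       (P0 A = zeta%:E * \d_(x0 : borel T) A + (1 - zeta)%:E * Pstar A)%E)
    (n k : nat) (k_gt0 : (1 <= k)%N) (k_le_n : (k <= n)%N)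
    (d : measure_display) (Omega : measurableType d)
    (P : probability Omega R)
    (Ptilde : {RV P >-> pprobability (borel T) R})
    (X : 'I_n -> {RV P >-> borel T})
    (X_model : hNRMI_sample Ptilde X rho c P0)
    (d' : measure_display) (Omega' : measurableType d')
    (P' : probability Omega' R)
    (Ptilde' : {RV P' >-> pprobability (borel T) R})
    (X' : 'I_n -> {RV P' >-> borel T})
    (X'_model : hNRMI_sample Ptilde' X' rho c Pstar) :
  let K := distinct_values (fun i => X i : Omega -> borel T) in
  let K' := distinct_values (fun i => X' i : Omega' -> borel T) in
  let N0 := count_at (fun i => X i : Omega -> borel T) x0 in
  prob P [set w | K n w = k] =
    (1 - zeta) ^+ k * prob P' [set w | K' n w = k] +
    (1 - zeta) ^+ (k - 1) *
      \sum_(1 <= r < (n - k + 1).+1)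
        'C(n, r)%:R * prob P' [set w | K' (n - r)%N w = (k - 1)%N] *
        cond_prob P [set w | N0 w = r]
          [set w | K (n - r)%N w = (k - 1)%N /\
                   forall i : 'I_n, (i < n - r)%N -> X i w <> x0].
Proof.
have [B sepB] := polish_separating polishT.
have beta01 : 0 <= 1 - zeta <= 1 by lra.
(* On sets that miss [x0] the Dirac part contributes nothing, which gives beta = 1 - zeta. *)
have HE (A : set (borel T)) : measurable A -> ~ A x0 ->
    fine (P0 A) = (1 - zeta) * fine (Pstar A).
  move=> mA Ax0; rewrite P0E// diracE memNset// mule0 add0e.
  by rewrite fineM// fin_num_measure.
exact: (prob_distinct_atom_mixture rho_meas rho_ge0 rho_infinite c_gt0 sepB
  Pstar_diffuse X_model beta01 HE X'_model k_gt0 k_le_n).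
Qed.
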